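(* There exists an absolute constant $d_0\ge 3$ such that the following holds. Let $\alpha>48$ and $\beta\ge\frac{16}{9}(\sqrt{12}+2\sqrt{\alpha})^2$. Then there is a constant $C>0$, depending only on $\alpha$ and $\beta$ (in particular not on $d,s,\sigma$), such that for all integers $d\ge d_0$, all $\sigma>0$ and all integers $s$ with $1\le s<d/2$, the estimator $\hat L'$ (defined in the context with tuning parameters $\alpha,\beta$; it does not use $s$ or $\sigma$) satisfies $$\sup_{\theta\in\Theta_s}\mathbf{E}_\theta\big(\hat L'-L(\theta)\big)^2\le C\,\sigma^2s^2\log\Big(1+\frac{d\log d}{s^2}\Big).$$
   Context: Model: one observes $y=(y_1,\dots,y_d)$ with $y_j=\theta_j+\sigma\xi_j$, $j=1,\dots,d$, where $\theta\in\mathbb{R}^d$ is unknown, $\xi_j$ are i.i.d. standard normal and $\sigma>0$ is unknown; $\mathbf{E}_\theta$ is the expectation under the law of $y$. $L(\theta)=\sum_{i=1}^d\theta_i$. $\Theta_s=\{\theta\in\mathbb{R}^d:\|\theta\|_0\le s\}$, where $\|\theta\|_0$ is the number of nonzero components. $\log$ is the natural logarithm, $\mathbf 1$ denotes an indicator. Estimator. Let $y_{(1)}^2\le\dots\le y_{(d)}^2$ be the order statistics of $y_1^2,\dots,y_d^2$ and $$\hat\sigma=9\Big(\frac1{\lfloor d/2\rfloor}\sum_{j\le d/2}y_{(j)}^2\Big)^{1/2}.$$ For $s=1,\dots,d$ set $$\hat L'_s=\begin{cases}\sum_{j=1}^d y_j\,\mathbf 1_{\{y_j^2>\alpha\hat\sigma^2\log(1+d(\log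 d)/s^2)\}}, & s\le\sqrt{d\log d/2},\\ \sum_{j=1}^d y_j,&\text{otherwise,}\end{cases}$$ and let $\omega'_s>0$ be given by $(\omega_s')^2=\beta\hat\sigma^2s^2\log(1+d(\log d)/s^2)$. Define $$\hat s'=\min\Big\{s\in\{1,\dots,\lfloor\sqrt{d\log d/2}\rfloor\}:\ |\hat L'_s-\hat L'_{s'}|\le\omega'_{s'}\ \text{for all } s'\in\{s+1,\dots,d\}\Big\},$$ with the convention $\hat s'=\lfloor\sqrt{d\log d/2}\rfloor+1$ if this set is empty. Finally $\hat L'=\hat L'_{\hat s'}$. (Here $\sqrt{d\log d/2}$ means $\sqrt{(d\log d)/2}$.) *)

(* Defs.v *)
From HB Require Import structures.
From mathcomp Require Import all_boot all_order all_algebra.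
From mathcomp Require Import all_classical all_reals all_analysis.

Set Implicit Arguments.
Unset Strict Implicit.
Unset Printing Implicit Defensive.

Import Order.TTheory GRing.Theory Num.Theory.
Import numFieldNormedType.Exports.

Local Open Scope classical_set_scope.
Local Open Scope ring_scope.

Section Probability.
Context (disp : measure_display) (T : measurableType disp) (R : realType).
Context (P : probability T R).

Definition mutually_independent (I : finType) (X : I -> {RV P >-> R}) : Prop :=
  forall (J : {set I}) (A : I -> set R), (forall i, measurable (A i)) ->
    P (\bigcap_(i in [set` J]) (X i @^-1` A i)) =
    (\prod_(i in J) P (X i @^-1` A i))%E.

Definition iid_standard_normal (I : finType) (X : I -> {RV P >-> R}) : Prop :=
  mutually_independent X /\
  forall i (A : set R), measurable A ->
    distribution P (X i) A = normal_prob 0 1 A.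

End Probability.

Section Estimator.
Context (R : realType) (d : nat).
Implicit Types (theta y : 'I_d -> R) (s : nat).

Definition norm0 theta : nat := #|[set i | theta i != 0]%SET|.

Definition sparse_vectors s : set ('I_d -> R) := [set theta | (norm0 theta <= s)%N].

Definition linear_functional theta : R := \sum_(i < d) theta i.

(* Indexed from 0: [order_stat_sq y j] is the (j+1)-th smallest of the y_i^2. *)
Definition order_stat_sq y (j : nat) : R :=
  (sort <=%R [seq y i ^+ 2 | i : 'I_d])`_j.

Definition sigma_hat y : R :=
  9 * Num.sqrt ((d./2%:R)^-1 * \sum_(0 <= j < d./2) order_stat_sq y j).

Definition log_factor s : R := ln (1 + d%:R * ln d%:R / s%:R ^+ 2).

Definition threshold_level : R := Num.sqrt (d%:R * ln d%:R / 2).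

Definition L_hat_at (alpha : R) y s : R :=
  if s%:R <= threshold_level then
    \sum_(j < d | alpha * sigma_hat y ^+ 2 * log_factor s < y j ^+ 2) y j
  else \sum_(j < d) y j.

Definition omega (beta : R) y s : R :=
  Num.sqrt (beta * sigma_hat y ^+ 2 * s%:R ^+ 2 * log_factor s).

Definition admissible (alpha beta : R) y s : bool :=
  all (fun s' => `|L_hat_at alpha y s - L_hat_at alpha y s'| <= omega beta y s')
      (index_iota s.+1 d.+1).

(* All candidates are at most [Num.truncn threshold_level], so the neutral value
   of the minimum is returned exactly when there is no admissible one. *)
Definition s_hat (alpha beta : R) y : nat :=
  \big[minn/(Num.truncn threshold_level).+1]_(1 <= s <
      (Num.truncn threshold_level).+1 | admissible alpha beta y s) s.

Definition L_hat (alpha beta : R) y : R :=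
  L_hat_at alpha y (s_hat alpha beta y).

End Estimator.

(* Main.v *)
(* Write N = d ln d and q(r) = r^2 log(1 + N / r^2), so that the target rate is
   sigma^2 q(s).

   Off the support of theta the signs of the y_j are fair coins given
   everything else, while the selection indicators and sigma_hat only see the
   y_j^2. Averaging over these signs bounds the Laplace transform of the
   off-support part of any thresholded sum by a product of one-dimensional
   Gaussian integrals, although the threshold is random. On the event
   sigma <= sigma_hat, whose complement has exponentially small probability, this
   shows that s <= sqrt (N / 2) is admissible except with probability O(d^-2).

   If s is admissible, the selected estimator is within omega_s of the one with
   index s. If it is not, comparison with the index just above sqrt (N / 2)
   still keeps the estimator within sigma_hat sqrt (beta N) of the sum of the
   y_j, which is affordable on an event of probability O(d^-2). That same
   comparison alone settles s > sqrt (N / 2), where q(s) >= N / 2.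

   Expectations are bounded through measurable majorants, so the estimator
   itself is never shown to be measurable. *)
Require Import Defs.
From HB Require Import structures.
From mathcomp Require Import all_boot all_order all_algebra.
From mathcomp Require Import all_classical all_reals all_analysis.
From mathcomp Require Import measurable_realfun.
From mathcomp Require Import zify ring lra.
Import Order.TTheory GRing.Theory Num.Theory.
Import numFieldNormedType.Exports.
Local Open Scope classical_set_scope.
Local Open Scope ring_scope.
Set Implicit Arguments.
Unset Strict Implicit.
Unset Printing Implicit Defensive.

(** * Resampling one coordinate of the noise *)

Section ProductSigmaAlgebra.
Context (R : realType) (d : nat).

(** The summands of a thresholded sum are coupled through [sigma_hat], so independence is exploited
    one coordinate at a time: replacing [xi k] by a fresh copy yields both the sign flips and the
    product bounds. After sign averaging only squares remain, and every moment, exponential or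
    polynomial, comes from the single integral of exp (u^2 / 4).

    Constants: [sqrt beta] pays [sqrt alpha] for the support and leaves at least 16 for the noise.
    With lambda = ln d / (4 sqrt (q r)), a noise sum beyond 16 sqrt (q r) has probability O(d^-3),
    and a union bound over d indices r gives d^-2.

    Upper expectations are only monotone, subadditive and positively homogeneous, so Cauchy-Schwarz
    on an exceptional event A is replaced by Z 1_A <= eta 1_A / 2 + Z^2 / (2 eta), with eta
    balancing the two terms. *)

Definition box (B : 'I_d -> set R) : set ('I_d -> R) :=
  [set x | forall i, B i (x i)].

Definition boxes : set (set ('I_d -> R)) :=
  [set box B | B in [set B | forall i, measurable (B i)]].

(** The function space with its product sigma-algebra; boxes are a generating pi-system. *)
Definition vec := g_sigma_algebraType boxes.

Definition upd (k : 'I_d) (u : R) (x : vec) : vec :=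
  fun i => if i == k then u else x i.

Lemma boxes_setI : setI_closed boxes.
Proof.
move=> _ _ [A mA <-] [B mB <-]; exists (fun i => A i `&` B i).
  by move=> i; apply: measurableI.
apply/seteqP; split=> x; rewrite /box/=; first by move=> h; split=> i; case: (h i).
by move=> [hA hB] i; split.
Qed.

Lemma boxes_setT : boxes setT.
Proof. by exists (fun=> setT) => //; apply/seteqP; split. Qed.

Lemma measurable_coord (i : 'I_d) : measurable_fun setT (fun x : vec => x i).
Proof.
move=> _ A mA; rewrite setTI; apply: sub_sigma_algebra.
exists (fun j => if j == i then A else setT); first by move=> j /=; case: ifP.
apply/seteqP; split=> x /=; first by move=> /(_ i); rewrite eqxx.
by move=> Ax j; case: eqP => // ->.
Qed.

Lemma measurable_vec disp (T : measurableType disp) (f : T -> vec) :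
  (forall i, measurable_fun setT (fun t => f t i)) -> measurable_fun setT f.
Proof.
move=> mf; apply: (@measurability _ _ _ (vec) _ _ boxes) => //.
move=> _ [_ [B mB <-] <-]; rewrite setTI.
have -> : f @^-1` box B = \bigcap_(i in [set: 'I_d]) (fun t => f t i) @^-1` B i.
  by apply/seteqP; split=> t /=; [move=> h i _; exact: h | move=> h i; exact: h].
apply: fin_bigcap_measurable => // i _.
by rewrite -[X in measurable X]setTI; apply: mf.
Qed.

Lemma measurable_upd k : measurable_fun setT (fun p : R * vec => upd k p.1 p.2).
Proof.
apply: measurable_vec => i; rewrite /upd; case: eqP => _.
  exact: measurable_fst.
by apply: (measurableT_comp (measurable_coord i)); exact: measurable_snd.
Qed.

(** Provides the generating pi-system on which two laws on [R * vec R d] have to be compared. *)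
Lemma measurable_prod_boxes :
  @measurable _ (R * vec)%type =
  <<s [set A `*` B | A in @measurable _ R & B in boxes] >>.
Proof.
set G := (X in <<s X >>).
have snd_meas : measurable_fun setT (fun p : g_sigma_algebraType G => p.2 : vec).
  apply: (@measurability _ _ _ vec _ _ boxes) => //.
  move=> _ [B bB <-]; rewrite setTI; apply: sub_sigma_algebra.
  by exists setT => //; exists B => //; apply/seteqP; split=> x //= [].
apply/seteqP; split.
  apply: smallest_sub; first exact: smallest_sigma_algebra.
  move=> _ [[A mA <-]|[B mB <-]]; rewrite setTI.
    apply: sub_sigma_algebra; exists A => //; exists setT; first exact: boxes_setT.
    by apply/seteqP; split=> x //= [].
  by have := snd_meas measurableT _ mB; rewrite setTI.
apply: smallest_sub; first exact: sigma_algebra_measurable.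
by move=> _ [A mA [B bB <-]]; apply: measurableX => //; apply: sub_sigma_algebra.
Qed.

End ProductSigmaAlgebra.

Section Resampling.
Context (R : realType) (d : nat) (disp : measure_display) (T : measurableType disp).
Context (P : probability T R) (xi : 'I_d -> {RV P >-> R}).
Hypothesis xi_indep : mutually_independent xi.

Definition noise (w : T) : vec R d := fun i => xi i w.

Lemma measurable_noise : measurable_fun setT noise.
Proof. by apply: measurable_vec => i; exact: measurable_funP. Qed.

(** Coordinate k is zeroed rather than dropped: the rest of the noise keeps the type [vec R d], and
    [upd k] overwrites the zero. *)
Let Y (k : 'I_d) (w : T) : vec R d := upd k 0 (noise w).

Let mY k : measurable_fun setT (Y k).
Proof.
apply: measurable_vec => i; rewrite /Y /upd /noise; case: eqP => _ //.
Qed.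

Let Z (k : 'I_d) (w : T) : R * vec R d := (xi k w, Y k w).

Let mZ k : measurable_fun setT (Z k).
Proof. by apply/measurable_fun_pairP; split => //; exact: mY. Qed.

Let Yk k : {mfun T >-> vec R d} :=
  HB.pack (Y k) (isMeasurableFun.Build _ _ _ _ _ (mY k)).

Let Zk k : {mfun T >-> (R * vec R d)%type} :=
  HB.pack (Z k) (isMeasurableFun.Build _ _ _ _ _ (mZ k)).


Lemma noise_coord_indep (k : 'I_d) (A : set R) (B : 'I_d -> set R) :
  measurable A -> (forall i, measurable (B i)) ->
  P (xi k @^-1` A `&` Y k @^-1` box B) =
  (P (xi k @^-1` A) * P (Y k @^-1` box B))%E.
Proof.
(* Coordinate k of [Y k] is constantly 0, so a box whose k-th side misses 0 is never hit. *)
move=> mA mB; have [B0|B0] := pselect (B k 0); last first.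
  have -> : Y k @^-1` box B = set0.
    by apply/seteqP; split=> // w /= /(_ k); rewrite /Y /upd eqxx.
  by rewrite setI0 !measure0 mule0.
pose C i := if i == k then A else B i.
have mC i : measurable (C i) by rewrite /C; case: ifP.
have -> : Y k @^-1` box B = \bigcap_(i in [set` [set~ k]%SET]) (xi i @^-1` C i).
  apply/seteqP; split=> w /= h.
    move=> i /=; rewrite !inE /C => /negbTE ik; have := h i.
    by rewrite /Y /upd ik.
  move=> i; rewrite /Y /upd; case: eqP => [->//|/eqP ik].
  by have := h i; rewrite /= !inE /C (negbTE ik); apply.
have -> : xi k @^-1` A `&` \bigcap_(i in [set` [set~ k]%SET]) (xi i @^-1` C i) =
    \bigcap_(i in [set` [set: 'I_d]%SET]) (xi i @^-1` C i).
  apply/seteqP; split=> w /=.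
    move=> [wA wC] i _; case: (eqVneq i k) => [->|ik]; first by rewrite /C eqxx.
    by apply: wC; rewrite /= !inE.
  move=> h; split; first by have := h k; rewrite /C eqxx; apply; rewrite /= inE.
  by move=> i _; apply: h; rewrite /= inE.
rewrite !xi_indep//.
rewrite (bigD1 k) ?inE//= {1}/C eqxx; congr (_ * _)%E.
by apply: eq_bigl => i; rewrite !inE.
Qed.

Lemma joint_law k (D : set (R * vec R d)) : measurable D ->
  (distribution P (xi k) \x distribution P (Yk k))%E D = distribution P (Zk k) D.
Proof.
pose G := [set A `*` B | A in @measurable _ R & B in @boxes R d].
apply: (@measure_unique _ R (R * vec R d)%type G (fun=> setT) _ _ _ _
  (distribution P (xi k) \x distribution P (Yk k))%E (distribution P (Zk k))).
- exact: measurable_prod_boxes.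
- move=> _ _ [A mA [B bB <-]] [A' mA' [B' bB' <-]].
  exists (A `&` A'); first exact: measurableI.
  by exists (B `&` B'); [exact: boxes_setI | rewrite setXI].
- move=> _; exists setT => //; exists setT; first exact: boxes_setT.
  by rewrite setXTT.
- by rewrite bigcup_const//; exists 0%N.
- move=> _ [A mA [_ [B mB <-] <-]].
  have mB' : @measurable _ (vec R d) (box B) by apply: sub_sigma_algebra; exists B.
  apply: (etrans (@product_measure1E _ _ _ _ _ (distribution P (xi k))
    (distribution P (Yk k)) A (box B) mA mB')).
  by rewrite /distribution /pushforward /= -noise_coord_indep.
- move=> _.
  have fin : ((distribution P (xi k) \x distribution P (Yk k))
      (setT `*` setT) < +oo)%E.
    by rewrite product_measure1E//= /distribution /pushforward !preimage_setT
      !probability_setT mule1 ltry.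
  by rewrite -setXTT; exact: fin.
Qed.

(** The joint law of [xi k] and [Y k] is a product, so Tonelli integrates coordinate k first. Every
    later use of independence goes through this identity. *)
Lemma resample (k : 'I_d) (F : vec R d -> \bar R) :
  measurable_fun [set: vec R d] F -> (forall x, 0 <= F x)%E ->
  (\int[P]_w F (noise w) = \int[P]_w \int[distribution P (xi k)]_u F (upd k u (noise w)))%E.
Proof.
move=> mF F0; pose f (p : R * vec R d) := F (upd k p.1 p.2).
have mf : measurable_fun setT f by apply: measurableT_comp => //; exact: measurable_upd.
have f0 p : (0 <= f p)%E by exact: F0.
have fY u w : f (u, Y k w) = F (upd k u (noise w)).
  by rewrite /f /=; congr F; apply/funext => i; rewrite /Y /upd /=; case: (i == k).
transitivity (\int[distribution P (Zk k)]_p f p)%E.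
  rewrite ge0_integral_distribution//; apply: eq_integral => w _ /=.
  rewrite fY; congr F; apply/funext => i; rewrite /upd.
  by case: eqP => [->|].
transitivity (\int[distribution P (xi k) \x distribution P (Yk k)]_p f p)%E.
  by apply: eq_measure_integral => D mD _; apply: esym; exact: (joint_law k mD).
rewrite (fubini_tonelli2 f mf f0).
have mG := @measurable_fun_fubini_tonelli_G _ _ _ _ _ (distribution P (xi k)) f mf f0.
rewrite (ge0_integral_distribution (Yk k) mG); last first.
  by move=> y; apply: integral_ge0 => u _; exact: f0.
by apply: eq_integral => w _ /=; apply: eq_integral => u _; rewrite fY.
Qed.
End Resampling.

(** * Power series bound for the hyperbolic cosine *)

Section ExponentialBounds.
Context (R : realType).
Implicit Types t u x : R.

Lemma fact_double_ge m : (2 ^ m * m`! <= (m.*2)`!)%N.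
Proof.
elim: m => // m IH; rewrite doubleS !factS expnS mulnACA [X in (_ <= X)%N]mulnA.
apply: leq_mul => //; apply: (@leq_trans (m.*2.+2 * 1)%N); last exact: leq_mul.
by rewrite muln1 -doubleS mul2n.
Qed.

(** The odd terms of the two series cancel, and 2^m m! <= (2m)! bounds each even term t^(2m) / (2m)!
    by (t^2 / 2)^m / m!. Hence 2n terms on the left are compared with n terms on the right. *)
Lemma cosh_le t : expR t + expR (- t) <= 2 * expR (t ^+ 2 / 2).
Proof.
pose f := series (exp_coeff t); pose g := series (exp_coeff (- t)).
have cf : cvgn f by exact: is_cvg_series_exp_coeff.
have cg : cvgn g by exact: is_cvg_series_exp_coeff.
have term0 k : 0 <= exp_coeff t k + exp_coeff (- t) k.
  rewrite /exp_coeff /= -mulrDl mulr_ge0 ?invr_ge0 ?ler0n// exprNn -signr_odd.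
  case: (boolP (odd k)) => ok; first by rewrite expr1 mulN1r subrr.
  by rewrite expr0 mul1r addr_ge0 // exprn_even_ge0.
have fgE n : f n + g n = \sum_(0 <= k < n) (exp_coeff t k + exp_coeff (- t) k).
  by rewrite /f /g /series /= big_split.
have bound n : f n.*2 + g n.*2 <= 2 * series (exp_coeff (t ^+ 2 / 2)) n.
  rewrite fgE /series /= mulr_sumr; elim: n => [|n IH]; first by rewrite !big_nil.
  rewrite doubleS !big_nat_recr //= -addrA lerD//.
  rewrite /exp_coeff /= exprNn -signr_odd /= odd_double expr0 mul1r.
  rewrite [X in _ + X](_ : _ = 0) ?addr0; last first.
    by rewrite exprNn -signr_odd /= odd_double expr1 mulN1r mulNr subrr.
  rewrite -[leLHS]mul1r -mulr2n -[X in _ * X]mulr_natl mul1r ler_pM2l//.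
  rewrite -mul2n exprM expr_div_n -mulrA ler_wpM2l ?(exprn_ge0 _ (sqr_ge0 t))//.
  rewrite -invfM lef_pV2 ?posrE ?mulr_gt0 ?exprn_gt0 ?ltr0n ?fact_gt0//.
  by rewrite -natrX -natrM ler_nat mul2n fact_double_ge.
rewrite /expR -limD//; apply: limr_le; first exact: is_cvgD.
apply: nearW => n; apply: (@le_trans _ _ (f n.*2 + g n.*2)).
  have nn : (n <= n.*2)%N by rewrite -addnn leq_addr.
  rewrite !fgE [leRHS](big_cat_nat (leq0n n) nn) /=.
  by rewrite (fgE n : (f + g) n = _) lerDl sumr_ge0.
apply: (le_trans (bound n)); rewrite ler_pM2l//.
apply: nondecreasing_cvgn_le; last exact: is_cvg_series_exp_coeff.
apply/nondecreasing_series => k _ _; apply: exp_coeff_ge0.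
by rewrite divr_ge0 ?sqr_ge0.
Qed.

End ExponentialBounds.

(** * Standard normal integrals *)

Section StandardNormal.
Context (R : realType).
Notation mu := (@lebesgue_measure R).

(** Change of variables produces the Radon-Nikodym derivative, which agrees almost everywhere with
    the density because both have the same integral over every measurable set. *)
Lemma integral_normal_prob (m s : R) (h : R -> \bar R) :
  measurable_fun setT h -> (forall u, 0 <= h u)%E ->
  (\int[normal_prob m s]_u h u = \int[mu]_u (h u * (normal_pdf m s u)%:E))%E.
Proof.
move=> mh h0; have dom := @normal_prob_dominates R m s.
rewrite -(Radon_Nikodym_SigmaFinite.change_of_variables dom)//=.
have intRN := Radon_Nikodym_SigmaFinite.f_integrable dom.
have mpdf : measurable_fun setT (EFin \o normal_pdf m s).
  by apply/measurable_EFinP; exact: measurable_normal_pdf.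
apply: ae_eq_integral => //.
- by apply: emeasurable_funM => //; exact: (measurable_int _ intRN).
- exact: emeasurable_funM.
- apply: ae_eqe_mul2l; apply: integral_ae_eq => // E _ mE.
  by rewrite -Radon_Nikodym_SigmaFinite.f_integral.
Qed.

Lemma integral_lebesgueN (h : R -> \bar R) :
  measurable_fun setT h -> (forall u, 0 <= h u)%E ->
  (\int[mu]_u h u = \int[mu]_u h (- u)%R)%E.
Proof.
move=> mh h0.
have mN : measurable_fun setT (-%R : R -> measurableTypeR R) by exact: oppr_measurable.
transitivity (\int[pushforward mu (-%R : R -> measurableTypeR R)]_u h u)%E.
  by apply: eq_measure_integral => A mA _; apply: esym; exact: (lebesgue_measureN mA).
by rewrite ge0_integral_pushforward.
Qed.

Lemma integral_normalN (h : R -> \bar R) :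
  measurable_fun setT h -> (forall u, 0 <= h u)%E ->
  (\int[normal_prob 0 1]_u h u = \int[normal_prob 0 1]_u h (- u)%R)%E.
Proof.
move=> mh h0.
have mhN : measurable_fun setT (fun u : R => h (- u)).
  by apply: measurableT_comp => //; exact: oppr_measurable.
rewrite !integral_normal_prob// integral_lebesgueN.
- apply: eq_integral => u _; congr (_ * _%:E)%E.
  by rewrite /normal_pdf oner_eq0 /normal_fun !subr0 sqrrN.
- apply: emeasurable_funM => //.
  by apply/measurable_EFinP; exact: measurable_normal_pdf.
- by move=> u; rewrite mule_ge0// lee_fin normal_pdf_ge0.
Qed.

(* Multiplying the standard density by [exp (u^2/4)] gives [sqrt 2] times the
   density of variance 2. *)
Lemma integral_normal_exp_sq :
  (\int[@normal_prob R 0 1]_u (expR (u ^+ 2 / 4))%:E = (Num.sqrt 2)%:E)%E.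
Proof.
have mexp : measurable_fun setT (fun u : R => expR (u ^+ 2 / 4)).
  by apply: measurableT_comp => //; apply: measurable_funM.
rewrite integral_normal_prob; last 2 first.
- exact/measurable_EFinP.
- by move=> u; rewrite lee_fin expR_ge0.
have s2 : Num.sqrt 2 != 0 :> R by rewrite sqrtr_eq0 -ltNge.
have peak : normal_peak 1 = Num.sqrt 2 * normal_peak (Num.sqrt 2) :> R.
  rewrite /normal_peak sqr_sqrtr// expr1n mul1r -mulrnAr sqrtrM// invfM.
  by rewrite mulrA divff ?mul1r.
transitivity (\int[mu]_u ((Num.sqrt 2)%:E * (normal_pdf 0 (Num.sqrt 2) u)%:E))%E.
  apply: eq_integral => u _; rewrite -!EFinM; congr _%:E.
  rewrite /normal_pdf oner_eq0 (negbTE s2) /normal_fun subr0 expr1n sqr_sqrtr//.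
  rewrite peak mulrC -!mulrA; congr (_ * (_ * _)).
  by rewrite -expRD; congr expR; field.
rewrite ge0_integralZl//=.
- by rewrite integral_normal_pdf mule1.
- by apply/measurable_EFinP; exact: measurable_normal_pdf.
- by move=> u _; rewrite lee_fin normal_pdf_ge0.
Qed.

(** The density is at most 1 / sqrt (2 pi) <= 1/2, since pi >= 2. *)
Lemma normal_prob_itv_le (a b : R) : a <= b ->
  (normal_prob 0 1 `[a, b]%classic <= ((b - a) / 2)%:E)%E.
Proof.
move=> ab; rewrite /normal_prob.
apply: (@le_trans _ _ (\int[mu]_(x in `[a, b]%classic) (2^-1)%:E)%E).
  apply: ge0_le_integral => //=.
  - by move=> x _; rewrite lee_fin normal_pdf_ge0.
  - by apply/measurable_funTS/measurable_EFinP; exact: measurable_normal_pdf.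
  - move=> x _; rewrite lee_fin (le_trans (normal_pdf_ub _ _ _))//.
    rewrite /normal_peak lef_pV2 ?posrE ?sqrtr_gt0//; last first.
      by rewrite expr1n mul1r mulrn_wgt0// pi_gt0.
    rewrite -[leLHS]gtr0_norm// -sqrtr_sqr ler_wsqrtr// expr1n mul1r.
    rewrite (_ : 2 ^+ 2 = 2 *+ 2); first by rewrite ler_wMn2r// pi_ge2.
    by rewrite expr2 mulr_natr.
rewrite integral_cst//= lebesgue_measure_itv/= lte_fin.
case: ltP => _; first by rewrite -EFinB -EFinM lee_fin mulrC.
by rewrite mule0 lee_fin divr_ge0// subr_ge0.
Qed.

End StandardNormal.

(** * Upper expectations *)

Section UpperExpectation.
Context (R : realType) (d : nat) (disp : measure_display) (T : measurableType disp).
Context (P : probability T R) (xi : 'I_d -> {RV P >-> R}).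
Implicit Types (F G H : vec R d -> R) (c : R).

(** An upper expectation. The majorant is a function of the noise vector, the space on which
    resampling and flipping act. *)
Definition exp_le F c : Prop := exists H : vec R d -> R,
  [/\ measurable_fun setT H, forall x, 0 <= H x, forall x, F x <= H x &
      (\int[P]_w (H (noise xi w))%:E <= c%:E)%E].

Lemma measurable_comp_noise H : measurable_fun setT H ->
  measurable_fun setT (fun w => (H (noise xi w))%:E).
Proof.
move=> mH; apply/measurable_EFinP; apply: (measurableT_comp mH).
exact: measurable_noise.
Qed.

Lemma exp_leW F G c c' : (forall x, F x <= G x) -> c <= c' ->
  exp_le G c -> exp_le F c'.
Proof.
move=> FG cc' [H [mH H0 GH Hc]]; exists H; split=> //.
  by move=> x; exact: le_trans (FG x) _.
by apply: (le_trans Hc); rewrite lee_fin.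
Qed.

Lemma exp_le_integral H c : measurable_fun setT H -> (forall x, 0 <= H x) ->
  (\int[P]_w (H (noise xi w))%:E <= c%:E)%E -> exp_le H c.
Proof. by move=> mH H0 Hc; exists H. Qed.

Lemma exp_leD F G a b : exp_le F a -> exp_le G b ->
  exp_le (fun x => F x + G x) (a + b).
Proof.
move=> [H [mH H0 FH Ha]] [K [mK K0 GK Kb]].
exists (fun x => H x + K x); split.
- exact: measurable_funD.
- by move=> x; rewrite addr_ge0.
- by move=> x; rewrite lerD.
- under eq_integral do rewrite EFinD.
  rewrite ge0_integralD//; first by rewrite EFinD leeD.
  + by move=> w _; rewrite lee_fin.
  + exact: measurable_comp_noise.
  + by move=> w _; rewrite lee_fin.
  + exact: measurable_comp_noise.
Qed.

Lemma exp_leZ F a c : 0 <= a -> exp_le F c -> exp_le (fun x => a * F x) (a * c).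
Proof.
move=> a0 [H [mH H0 FH Hc]]; exists (fun x => a * H x); split.
- exact: measurable_funM.
- by move=> x; rewrite mulr_ge0.
- by move=> x; rewrite ler_wpM2l.
- under eq_integral do rewrite EFinM.
  rewrite ge0_integralZl//; first by rewrite EFinM lee_wpmul2l.
  + exact: measurable_comp_noise.
  + by move=> w _; rewrite lee_fin.
Qed.

Lemma exp_le_cst c : 0 <= c -> exp_le (fun=> c) c.
Proof.
move=> c0; apply: exp_le_integral => //.
by rewrite integral_cst//= probability_setT mule1.
Qed.

Lemma exp_le_sum (I : Type) (r : seq I) (F : I -> vec R d -> R) (c : I -> R) :
  (forall i, exp_le (F i) (c i)) ->
  exp_le (fun x => \sum_(i <- r) F i x) (\sum_(i <- r) c i).
Proof.
move=> Fc; elim: r => [|i r IH].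
  rewrite big_nil; apply: exp_leW (exp_le_cst (lexx 0)) => // x.
  by rewrite big_nil.
rewrite big_cons; apply: exp_leW (exp_leD (Fc i) IH) => // x.
by rewrite big_cons.
Qed.

(* The integral of a nonnegative function is a supremum over the simple
   functions below it, so no measurability of F is needed here. *)
Lemma expectation_le_bound F c : (forall x, 0 <= F x) -> exp_le F c ->
  ('E_P[(fun w => F (noise xi w))] <= c%:E)%E.
Proof.
move=> F0 [H [mH H0 FH Hc]]; apply: le_trans Hc.
rewrite unlock !ge0_integralTE//=; last 2 first.
- by move=> w; rewrite lee_fin.
- by move=> w; rewrite lee_fin.
apply: le_ereal_sup => _ [h hF <-]; exists h => // w.
by apply: (le_trans (hF w)); rewrite lee_fin.
Qed.

Hypothesis xi_iid : iid_standard_normal xi.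

(** The pushforward along the identity only reconciles the two measurable structures carried by the
    real line. *)
Lemma integral_law k (h : R -> \bar R) :
  measurable_fun setT h -> (forall u, 0 <= h u)%E ->
  (\int[distribution P (xi k)]_u h u = \int[normal_prob 0 1]_u h u)%E.
Proof.
move=> mh h0.
have mid : measurable_fun setT (idfun : measurableTypeR R -> R).
  by move=> _ A mA; rewrite setTI.
transitivity (\int[pushforward (@normal_prob R 0 1)
    (idfun : measurableTypeR R -> R)]_u h u)%E.
  by apply: eq_measure_integral => A mA _; case: xi_iid => _ /(_ k A mA).
by rewrite ge0_integral_pushforward.
Qed.

Lemma integral_coord k (h : R -> \bar R) :
  measurable_fun setT h -> (forall u, 0 <= h u)%E ->
  (\int[P]_w h (xi k w) = \int[normal_prob 0 1]_u h u)%E.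
Proof.
by move=> mh h0; rewrite -(integral_law k)// ge0_integral_distribution.
Qed.

(** Induction on [r]: resampling the head k turns its factor into a one-dimensional integral, and
    the other factors do not see coordinate k because [r] is duplicate-free. *)
Lemma exp_le_prod (g : 'I_d -> R -> R) (c : 'I_d -> R) (r : seq 'I_d) :
  uniq r -> (forall i, measurable_fun setT (g i)) ->
  (forall i u, 0 <= g i u) ->
  (forall i, (\int[normal_prob 0 1]_u (g i u)%:E <= (c i)%:E)%E) ->
  exp_le (fun x => \prod_(i <- r) g i (x i)) (\prod_(i <- r) c i).
Proof.
move=> ur mg g0 gc.
have c0 i : 0 <= c i.
  rewrite -lee_fin; apply: le_trans (gc i).
  by apply: integral_ge0 => u _; rewrite lee_fin.
have mprod s : measurable_fun setT (fun x : vec R d => \prod_(i <- s) g i (x i)).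
  apply: measurable_prod => i _; apply: (measurableT_comp (mg i)).
  exact: measurable_coord.
have prod0 s (x : vec R d) : 0 <= \prod_(i <- s) g i (x i) by exact: prodr_ge0.
apply: exp_le_integral => //; elim: r ur => [_|k r IH /= /andP[kr ur]].
  under eq_integral do rewrite big_nil.
  by rewrite big_nil integral_cst//= probability_setT mule1.
rewrite (resample (proj1 xi_iid) k (F := fun x => (\prod_(i <- k :: r) g i (x i))%:E));
  last 2 first.
- exact/measurable_EFinP.
- by move=> x; rewrite lee_fin.
pose I := (\int[normal_prob 0 1]_u (g k u)%:E)%E.
have I0 : (0 <= I)%E by apply: integral_ge0 => u _; rewrite lee_fin.
have Iupd w : (\int[distribution P (xi k)]_u
      (\prod_(i <- k :: r) g i (upd k u (noise xi w) i))%:E =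
    (\prod_(i <- r) g i (noise xi w i))%:E * I)%E.
  rewrite integral_law//; last 2 first.
  - apply/measurable_EFinP; rewrite (_ : (fun _ => _) =
        fun u => g k u * \prod_(i <- r) g i (noise xi w i)); first exact: measurable_funM.
    apply/funext => u; rewrite big_cons /upd eqxx; congr (_ * _).
    apply: eq_big_seq => i ir; by case: eqP => // ik; move: kr; rewrite -ik ir.
  - by move=> u; rewrite lee_fin.
  rewrite muleC /I -ge0_integralZr//; last 3 first.
  - by apply/measurable_EFinP; exact: (mg k).
  - by move=> u _; rewrite lee_fin.
  - by rewrite lee_fin.
  apply: eq_integral => u _; rewrite -EFinM big_cons /upd eqxx; congr (_ * _)%:E.
  apply: eq_big_seq => i ir; by case: eqP => // ik; move: kr; rewrite -ik ir.
under eq_integral => w _ do rewrite Iupd.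
rewrite ge0_integralZr//; last 2 first.
- exact: (measurable_comp_noise (H := fun x => \prod_(i <- r) g i (x i))).
- by move=> w _; rewrite lee_fin.
rewrite muleC big_cons EFinM lee_pmul//.
- by apply: integral_ge0 => w _; rewrite lee_fin.
- exact: gc.
- exact: IH.
Qed.

Definition flip (k : 'I_d) (x : vec R d) : vec R d := upd k (- x k) x.

Lemma measurable_flip k : measurable_fun setT (flip k).
Proof.
apply: measurable_vec => i; rewrite /flip /upd; case: eqP => _.
  by apply: (measurableT_comp (@oppr_measurable _ _)); exact: measurable_coord.
exact: measurable_coord.
Qed.

(** Resampling coordinate k on both sides reduces this to the symmetry of the standard normal
    law. *)
Lemma integral_flip k H : measurable_fun setT H -> (forall x, 0 <= H x) ->
  (\int[P]_w (H (noise xi w))%:E = \int[P]_w (H (flip k (noise xi w)))%:E)%E.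
Proof.
move=> mH H0.
have mupd (y : vec R d) : measurable_fun setT (fun u : R => upd k u y).
  by apply: measurable_vec => i; rewrite /upd; case: eqP => _.
have mflip := measurable_flip k.
rewrite (resample (proj1 xi_iid) k (F := fun x => (H x)%:E)); last 2 first.
- exact/measurable_EFinP.
- by move=> x; rewrite lee_fin.
rewrite [RHS](resample (proj1 xi_iid) k (F := fun x => (H (flip k x))%:E)); last 2 first.
- by apply/measurable_EFinP; exact: (measurableT_comp mH mflip).
- by move=> x; rewrite lee_fin.
apply: eq_integral => w _.
have flip_upd u y : flip k (upd k u y) = upd k (- u) y.
  by apply/funext => i; rewrite /flip /upd eqxx; case: eqP.
rewrite !integral_law//; last 4 first.
- by apply/measurable_EFinP; apply: (measurableT_comp mH); apply: (measurableT_comp mflip).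
- by move=> u; rewrite lee_fin.
- by apply/measurable_EFinP; apply: (measurableT_comp mH).
- by move=> u; rewrite lee_fin.
rewrite integral_normalN//; last 2 first.
- by apply/measurable_EFinP; apply: (measurableT_comp mH).
- by move=> u; rewrite lee_fin.
by apply: eq_integral => u _; rewrite flip_upd.
Qed.

End UpperExpectation.

(** * Sign symmetry *)

Section SignSymmetry.
Context (R : realType) (d : nat) (disp : measure_display) (T : measurableType disp).
Context (P : probability T R) (xi : 'I_d -> {RV P >-> R}).
Hypothesis xi_iid : iid_standard_normal xi.
Implicit Types (H : vec R d -> R) (lam t : R).
Notation E H := (\int[P]_w (H (noise xi w))%:E)%E.

Lemma flip_neq (i k : 'I_d) (x : vec R d) : i != k -> flip k x i = x i.
Proof. by rewrite /flip /upd => /negbTE ->. Qed.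

Lemma flip_eq (k : 'I_d) (x : vec R d) : flip k x k = - x k.
Proof. by rewrite /flip /upd eqxx. Qed.

(** Averaging over the sign of x_k replaces exp (lam x_k a_k) by a hyperbolic cosine, at most exp
    (lam^2 (x_k a_k)^2 / 2). The weight [H] is there for the induction: it absorbs this factor,
    which is invariant under the remaining flips because k is not in the tail. *)
Lemma sign_average (r : seq 'I_d) (a : 'I_d -> vec R d -> R) lam H :
  uniq r -> measurable_fun setT H -> (forall x, 0 <= H x) ->
  (forall i, measurable_fun setT (a i)) ->
  (forall k x, k \in r -> H (flip k x) = H x) ->
  (forall i k x, k \in r -> a i (flip k x) = a i x) ->
  (E (fun x => (H x * expR (lam * \sum_(i <- r) x i * a i x))%R) <=
   E (fun x => (H x * expR (lam ^+ 2 / 2 * \sum_(i <- r) (x i * a i x) ^+ 2))%R))%E.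
Proof.
move=> ur mH H0 ma; elim: r ur H mH H0 => [_ H mH H0 _ _|k r IH /= /andP[kr ur] H mH H0 iH ia].
  rewrite le_eqVlt; apply/orP; left; apply/eqP; apply: eq_integral => w _.
  by rewrite !big_nil !mulr0.
have mxa i : measurable_fun setT (fun x : vec R d => x i * a i x).
  by apply: measurable_funM => //; exact: measurable_coord.
have msum s : measurable_fun setT (fun x : vec R d => \sum_(i <- s) x i * a i x).
  by apply: measurable_sum.
pose K x := H x * expR (lam ^+ 2 / 2 * (x k * a k x) ^+ 2).
have mK : measurable_fun setT K.
  apply: measurable_funM => //; apply: measurableT_comp => //.
  by apply: measurable_funM => //; exact: measurable_funX.
have K0 x : 0 <= K x by rewrite mulr_ge0 ?expR_ge0.
have rk j : j \in r -> k != j by move=> jr; apply: contraNneq kr => ->.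
have iK j x : j \in r -> K (flip j x) = K x.
  move=> jr; rewrite /K iH ?inE ?jr ?orbT// ia ?inE ?jr ?orbT//.
  by rewrite flip_neq ?rk.
have ir i j x : j \in r -> a i (flip j x) = a i x.
  by move=> jr; rewrite ia ?inE ?jr ?orbT.
apply: (@le_trans _ _ (E (fun x => (K x * expR (lam * \sum_(i <- r) x i * a i x))%R)));
  last first.
  apply: (le_trans (IH ur K mK K0 iK ir)); rewrite le_eqVlt; apply/orP; left; apply/eqP;
    apply: eq_integral => w _.
  by rewrite /K big_cons mulrDr expRD mulrA.
pose F x := H x * expR (lam * \sum_(i <- k :: r) x i * a i x).
pose D x := K x * expR (lam * \sum_(i <- r) x i * a i x).
have mF : measurable_fun setT F.
  by apply: measurable_funM => //; apply: measurableT_comp => //; apply: measurable_funM.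
have mD : measurable_fun setT D.
  by apply: measurable_funM => //; apply: measurableT_comp => //; apply: measurable_funM.
have F0 x : 0 <= F x by rewrite mulr_ge0 ?expR_ge0.
have D0 x : 0 <= D x by rewrite mulr_ge0 ?expR_ge0.
have mFf : measurable_fun setT (F \o flip k).
  exact: (measurableT_comp mF (measurable_flip k)).
have FD x : F x + F (flip k x) <= 2 * D x.
  have rest : \sum_(i <- r) flip k x i * a i (flip k x) = \sum_(i <- r) x i * a i x.
    apply: eq_big_seq => i ir'; rewrite ia ?inE ?eqxx// flip_neq// eq_sym.
    exact: rk.
  rewrite /F /D /K !big_cons rest flip_eq iH ?ia ?inE ?eqxx// !mulrDr !expRD.
  set e := expR (lam * \sum_(i <- r) _); set u := x k * a k x.
  have -> : lam * (- x k * a k x) = - (lam * u) by rewrite /u; ring.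
  have -> : lam ^+ 2 / 2 * u ^+ 2 = (lam * u) ^+ 2 / 2 by ring.
  have := cosh_le (lam * u); have e0 : 0 <= e by exact: expR_ge0.
  have := H0 x; move: (expR (lam * u)) (expR (- _)) (expR (_ / 2)) => p q s h0 pq.
  have -> : H x * (p * e) + H x * (q * e) = (H x * e) * (p + q) by ring.
  have -> : 2 * (H x * s * e) = (H x * e) * (2 * s) by ring.
  by rewrite ler_wpM2l// mulr_ge0.
(* One of the two copies of [E F] is flipped at k, so that the pointwise bound [FD] applies to their
   sum. *)
have : (2%:E * E F <= 2%:E * E D)%E.
  rewrite -[2]/(1 + 1) EFinD ge0_muleDl ?lee_fin// !mul1e.
  rewrite {2}(integral_flip xi_iid k)// -ge0_integralD//; last 4 first.
  - by move=> w _; rewrite lee_fin.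
  - exact: measurable_comp_noise.
  - by move=> w _; rewrite lee_fin.
  - exact: (measurable_comp_noise xi mFf).
  rewrite -EFinD -[1 + 1]/2 -ge0_integralZl//; last 2 first.
  - exact: measurable_comp_noise.
  - by move=> w _; rewrite lee_fin.
  apply: ge0_le_integral => //.
  - by move=> w _; rewrite adde_ge0 ?lee_fin.
  - by apply: emeasurable_funD;
    [exact: measurable_comp_noise | exact: (measurable_comp_noise xi mFf)].
  - by apply: emeasurable_funM => //; exact: measurable_comp_noise.
  - by move=> w _; rewrite -EFinD -EFinM lee_fin.
by rewrite lee_pmul2l.
Qed.

(** Convexity of exp between 0 and v. After division by exp (th v), the tangent bounds 1 + w <= exp
    w at w = - th v and w = v - th v, weighted by 1 - th and th, add up to 1. *)
Lemma expR_chord_le th v : 0 <= th <= 1 -> expR (th * v) <= 1 - th + th * expR v :> R.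
Proof.
move=> /andP[th0 th1].
have -> : 1 - th + th * expR v =
    expR (th * v) * ((1 - th) * expR (- (th * v)) + th * expR (v - th * v)).
  rewrite mulrDr !mulrA ![expR (th * v) * _]mulrC -!mulrA -!expRD.
  by rewrite subrr expR0 mulr1 subrKC.
rewrite ler_peMr ?expR_ge0//.
have h1 := expR_ge1Dx (- (th * v)); have h2 := expR_ge1Dx (v - th * v).
have : (1 - th) * (1 + - (th * v)) <= (1 - th) * expR (- (th * v)) by rewrite ler_wpM2l//
  subr_ge0.
have : th * (1 + (v - th * v)) <= th * expR (v - th * v) by rewrite ler_wpM2l.
lra.
Qed.

Lemma sqrt2_le : Num.sqrt 2 <= 3 / 2 :> R.
Proof.
rewrite -(@ler_pXn2r _ 2) ?nnegrE ?sqrtr_ge0// sqr_sqrtr//; lra.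
Qed.

Lemma exp_le_exp_sq i : exp_le xi (fun x => expR (x i ^+ 2 / 4)) (3 / 2).
Proof.
have mexp : measurable_fun setT (fun u : R => expR (u ^+ 2 / 4)).
  by apply: measurableT_comp => //; apply: measurable_funM.
apply: exp_le_integral.
- by apply: (measurableT_comp mexp); exact: measurable_coord.
- by move=> x; exact: expR_ge0.
rewrite (integral_coord xi_iid i (h := fun u => (expR (u ^+ 2 / 4))%:E)).
- by rewrite integral_normal_exp_sq lee_fin sqrt2_le.
- exact/measurable_EFinP.
- by move=> u; rewrite lee_fin expR_ge0.
Qed.

(** After sign averaging, a selected coordinate contributes exp (lam^2 x^2 / 2). The chord bound
    with th = 4 lam^2 <= 1 gives at most 1 + 4 lam^2 exp (x^2 / 8), and x^2 >= t gives exp (x^2 / 8)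
    <= exp (- t / 8) exp (x^2 / 4). The resulting factor no longer involves [b], so the coordinates
    decouple; each integral is at most 1 + 6 lam^2 exp (- t / 8). *)
Lemma exp_le_mgf (r : seq 'I_d) (b : 'I_d -> vec R d -> bool) (G : vec R d -> bool) lam t :
  uniq r ->
  (forall i, measurable_fun setT (fun x => (b i x)%:R : R)) ->
  measurable_fun setT (fun x => (G x)%:R : R) ->
  (forall k x, k \in r -> G (flip k x) = G x) ->
  (forall i k x, k \in r -> b i (flip k x) = b i x) ->
  (forall i x, i \in r -> G x -> b i x -> t <= x i ^+ 2) ->
  lam ^+ 2 <= 4^-1 ->
  exp_le xi (fun x => (G x)%:R * expR (lam * \sum_(i <- r) x i * (b i x)%:R))
    (expR (6 * lam ^+ 2 * d%:R * expR (- (t / 8)))).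
Proof.
move=> ur mb mG iG ib bt lam4; have lam0 := sqr_ge0 lam.
pose c := 4 * lam ^+ 2 * expR (- (t / 8)).
have c0 : 0 <= c by apply: mulr_ge0; [apply: mulr_ge0 | exact: expR_ge0].
have mexp : measurable_fun setT (fun u : R => expR (u ^+ 2 / 4)).
  by apply: measurableT_comp => //; apply: measurable_funM.
pose g (i : 'I_d) u := 1 + c * expR (u ^+ 2 / 4).
have g1 i u : 1 <= g i u by rewrite lerDl mulr_ge0 ?expR_ge0.
have g0 i u : 0 <= g i u by exact: le_trans (g1 i u).
have mg i : measurable_fun setT (g i) by apply: measurable_funD => //; exact: measurable_funM.
have Eg i : (\int[normal_prob 0 1]_u (g i u)%:E <= (1 + c * (3 / 2))%:E)%E.
  rewrite /g; under eq_integral do rewrite EFinD EFinM.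
  rewrite ge0_integralD//=; last 2 first.
  - by move=> u _; rewrite mule_ge0 ?lee_fin ?expR_ge0.
  - by apply: emeasurable_funM => //; exact/measurable_EFinP.
  rewrite integral_cst//= probability_setT mule1 ge0_integralZl//=; last first.
    by apply/measurable_EFinP; exact: mexp.
  rewrite integral_normal_exp_sq -EFinM -EFinD lee_fin lerD2l ler_wpM2l//.
  exact: sqrt2_le.
have mxb i : measurable_fun setT (fun x : vec R d => x i * (b i x)%:R).
  by apply: measurable_funM => //; exact: measurable_coord.
have [H [mH H0 gH Hc]] := exp_le_prod xi_iid ur mg g0 Eg.
apply: exp_le_integral.
- apply: measurable_funM => //; apply: measurableT_comp => //.
  by apply: measurable_funM => //; exact: measurable_sum.
- by move=> x; rewrite mulr_ge0 ?expR_ge0.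
apply: (le_trans (sign_average lam (a := fun i x => (b i x)%:R) ur mG _ mb _ _)) => //.
- by move=> k x kr; rewrite iG.
- by move=> i k x kr; rewrite ib.
apply: (@le_trans _ _ (E H)).
  apply: ge0_le_integral => //.
  - apply: (measurable_comp_noise xi (H := fun x =>
    (G x)%:R * expR (lam ^+ 2 / 2 * \sum_(i <- r) (x i * (b i x)%:R) ^+ 2))).
    apply: measurable_funM => //; apply: measurableT_comp => //.
    apply: measurable_funM => //; apply: measurable_sum => i.
    exact: measurable_funX.
  - exact: measurable_comp_noise.
  move=> w _; rewrite lee_fin; apply: le_trans (gH _).
  set x := noise xi w; case: (boolP (G x)) => Gx; last first.
    by rewrite mul0r prodr_ge0.
  rewrite mul1r mulr_sumr expR_sum !big_seq.
  apply: ler_prod => i ir; rewrite expR_ge0 /=.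
  case: (boolP (b i x)) => bx; last by rewrite mulr0 expr0n mulr0 expR0.
  have tx := bt i x ir Gx bx.
  rewrite mulr1; have -> : lam ^+ 2 / 2 * x i ^+ 2 = (4 * lam ^+ 2) * (x i ^+ 2 / 8) by field.
  have th01 : 0 <= 4 * lam ^+ 2 <= 1 by apply/andP; split; lra.
  apply: (le_trans (expR_chord_le _ th01)).
  rewrite /g /c -mulrA -expRD.
  have : expR (x i ^+ 2 / 8) <= expR (- (t / 8) + x i ^+ 2 / 4) by rewrite ler_expR; lra.
  move: th01 => /andP[th0 _] h; have := ler_wpM2l th0 h; lra.
apply: (le_trans Hc); rewrite lee_fin.
rewrite big_const_seq count_predT iter_mulr_1.
apply: (@le_trans _ _ (expR (c * (3 / 2)) ^+ size r)).
  by rewrite lerXn2r ?nnegrE ?expR_ge0 ?expR_ge1Dx// addr_ge0// mulr_ge0.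
rewrite -expRM_natl ler_expR.
have sr : (size r)%:R <= d%:R :> R.
  by rewrite ler_nat -(card_uniqP ur) -[leqRHS]card_ord max_card.
apply: (@le_trans _ _ (d%:R * (c * (3 / 2)))); first by rewrite ler_wpM2r// mulr_ge0.
by rewrite le_eqVlt /c; apply/orP; left; apply/eqP; field.
Qed.

End SignSymmetry.

(** * Sums of the smallest values *)

Section SmallestSum.
Context (R : realType) (d : nat).
Implicit Types (v : 'I_d -> R) (k : nat) (J : {set 'I_d}).

Definition smallest_sum v k : R :=
  \sum_(0 <= j < k) (sort <=%R [seq v i | i : 'I_d])`_j.

(** Sorting indices instead of values turns the sum of the smallest values into a sum over an index
    set. *)
Let ranking v := sort (relpre v <=%R) (enum 'I_d).

Let ranking_perm v : perm_eq (ranking v) (enum 'I_d).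
Proof. by rewrite /ranking perm_sort. Qed.

Let ranking_uniq v : uniq (ranking v).
Proof. by rewrite (perm_uniq (ranking_perm v)) enum_uniq. Qed.

Let ranking_size v : size (ranking v) = d.
Proof. by rewrite (perm_size (ranking_perm v)) size_enum_ord. Qed.

Let smallest_sumE v k : (k <= d)%N ->
  smallest_sum v k = \sum_(i <- take k (ranking v)) v i.
Proof.
move=> kd; rewrite /smallest_sum /image_mem sort_map -/(ranking v).
rewrite -(big_map v xpredT id) [RHS](big_nth 0) size_map size_takel ?ranking_size//.
by apply: eq_big_nat => j /andP[_ jk]; rewrite map_take nth_take.
Qed.

Lemma smallest_sum_attained v k : (k <= d)%N ->
  exists J : {set 'I_d}, #|J| = k /\ smallest_sum v k = \sum_(i in J) v i.
Proof.
move=> kd; exists [set i in take k (ranking v)].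
have ut : uniq (take k (ranking v)) by rewrite take_uniq.
split.
  rewrite cardsE (card_uniqP ut) size_takel// ranking_size//.
rewrite smallest_sumE// big_uniq//.
by apply: eq_bigl => i; rewrite inE.
Qed.

(* With t the k-th smallest value, the k smallest deviations from t sum to
   the sum of all negative parts [min (v i - t) 0]. *)
Lemma smallest_sum_le v k J : (forall i, 0 <= v i) -> (k <= #|J|)%N ->
  smallest_sum v k <= \sum_(i in J) v i.
Proof.
move=> v0 kJ.
have kd : (k <= d)%N by apply: (leq_trans kJ); rewrite -[leqRHS]card_ord max_card.
case: k => [|k] in kJ kd *; first by rewrite /smallest_sum big_nil sumr_ge0.
rewrite smallest_sumE//; set s := ranking v.
have sz : size s = d by exact: ranking_size.
have i0 : 'I_d by exact: (Ordinal kd).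
pose t := v (nth i0 s k).
have srt : sorted (relpre v <=%R) s.
  by apply: sort_sorted => x y /=; exact: le_total.
have tr : transitive (relpre v <=%R) by move=> x y z /=; exact: le_trans.
have nth_le a b : (a <= b < d)%N -> v (nth i0 s a) <= v (nth i0 s b).
  move=> /andP[ab bd]; rewrite leq_eqVlt in ab; case/orP: ab => [/eqP->//|ab].
  apply: (@sorted_ltn_nth _ (relpre v <=%R) tr i0 s srt a b) => //.
  + by rewrite inE sz (ltn_trans ab).
  + by rewrite inE sz.
pose m i := Num.min (v i - t) 0.
have small i : i \in take k.+1 s -> m i = v i - t.
  move=> /(nthP i0)[j]; rewrite size_takel ?sz// => jk <-.
  rewrite nth_take// /m min_l// subr_le0 nth_le//.
  by rewrite -ltnS jk.
have large i : i \in drop k.+1 s -> m i = 0.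
  move=> /(nthP i0)[j]; rewrite size_drop sz => jk <-.
  rewrite nth_drop /m min_r// subr_ge0 nth_le//.
  by rewrite (leq_trans (leqnSn k))/= ?leq_addr// -ltn_subRL.
have all_m : \sum_(i : 'I_d) m i = \sum_(i <- take k.+1 s) v i - t *+ k.+1.
  rewrite -big_enum /= -(perm_big _ (ranking_perm v)) -/s -{1}(cat_take_drop k.+1 s) big_cat /=.
  have -> : \sum_(i <- drop k.+1 s) m i = 0 by rewrite big_seq big1.
  rewrite addr0 big_seq (eq_bigr (fun i => v i - t)); last first.
    by move=> i; exact: small.
  rewrite -big_seq big_split /=; congr (_ + _).
  by rewrite big_const_seq count_predT size_takel ?sz// iter_addr_0 mulNrn.
have J_m : \sum_(i in J) (v i - t) >= \sum_(i : 'I_d) m i.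
  rewrite [leLHS](bigID (mem J)) /= -[leRHS]addr0 lerD//.
    by apply: ler_sum => i _; rewrite ge_min lexx.
  by apply: sumr_le0 => i _; rewrite ge_min lexx orbT.
have t0 : 0 <= t by exact: v0.
move: J_m; rewrite all_m sumrB sumr_const.
have : t *+ k.+1 <= t *+ #|J| by rewrite ler_wpMn2l.
lra.
Qed.

(** The sum of the k smallest values is a minimum of measurable sums over the finitely many index
    sets of size k; [J0], one of these sets, supplies the default value. *)
Lemma measurable_smallest_sum disp (T : measurableType disp) (f : 'I_d -> T -> R) k :
  (k <= d)%N -> (forall i, measurable_fun setT (f i)) -> (forall i x, 0 <= f i x) ->
  measurable_fun setT (fun x => smallest_sum (f ^~ x) k).
Proof.
move=> kd mf f0.
have [J0 [cJ0 _]] := smallest_sum_attained (fun=> 0) kd.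
have msum (J : {set 'I_d}) : measurable_fun setT (fun x => \sum_(i in J) f i x).
  under eq_fun do rewrite big_mkcond /=.
  by apply: measurable_sum => i; case: (i \in J).
pose F (J : {set 'I_d}) x := \sum_(i in J) f i x.
have -> : (fun x => smallest_sum (f ^~ x) k) =
    fun x => \big[Num.min/F J0 x]_(J : {set 'I_d} | #|J| == k) F J x.
  apply/funext => x; apply/eqP; rewrite eq_le; apply/andP; split.
    apply: le_bigmin => [|J /eqP cJ]; apply: smallest_sum_le => //.
      by rewrite cJ0.
    by rewrite cJ.
  have [J [/eqP cJ ->]] := smallest_sum_attained (f ^~ x) kd.
  exact: (bigmin_le_cond _ (F ^~ x)).
elim: (index_enum _) => [|J s IH].
  by under eq_fun do rewrite big_nil; exact: msum.
under eq_fun do rewrite big_cons /=; case: (#|J| == k) => //.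
by apply: measurable_minr => //; exact: msum.
Qed.

End SmallestSum.

(** * The noise level estimator *)

Section SigmaHat.
Context (R : realType) (d : nat).
Implicit Types (y : 'I_d -> R) (x : vec R d).

Lemma sigma_hat_ge0 y : 0 <= sigma_hat y.
Proof. by rewrite mulr_ge0 ?sqrtr_ge0. Qed.

Lemma smallest_sum_ge0 (v : 'I_d -> R) k : (k <= d)%N ->
  (forall i, 0 <= v i) -> 0 <= smallest_sum v k.
Proof.
by move=> kd v0; have [J [_ ->]] := smallest_sum_attained v kd; exact: sumr_ge0.
Qed.

Lemma half_le_d : (d./2 <= d)%N.
Proof. lia. Qed.

Lemma sigma_hat_sqr y : sigma_hat y ^+ 2 =
  81 * ((d./2)%:R^-1 * smallest_sum (fun i => y i ^+ 2) d./2).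
Proof.
rewrite exprMn sqr_sqrtr; first by congr (_ * _); ring.
rewrite mulr_ge0 ?invr_ge0//; apply: smallest_sum_ge0 half_le_d _ => i.
exact: sqr_ge0.
Qed.

Lemma eq_sigma_hat y y' : (forall i, y i ^+ 2 = y' i ^+ 2) -> sigma_hat y = sigma_hat y'.
Proof.
move=> yy'; rewrite /sigma_hat /order_stat_sq.
by rewrite (_ : [seq y i ^+ 2 | i : 'I_d] = [seq y' i ^+ 2 | i : 'I_d])//; exact: eq_map.
Qed.

(** At least 4/9 of the [d./2] smallest squares exceed sigma^2 / 36, and 81 * (4/9) / 36 = 1. *)
Lemma sigma_hat_lower y (sigma : R) : (10 <= d)%N -> 0 < sigma ->
  (4 * #|[set i | (36 * y i ^+ 2 <= sigma ^+ 2)%R]%SET| <= d)%N -> sigma <= sigma_hat y.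
Proof.
move=> d10 s0; set A := finset _ => Ad.
rewrite -(@ler_pXn2r _ 2) ?nnegrE ?(ltW s0) ?sigma_hat_ge0// sigma_hat_sqr.
have [J [cJ ->]] := smallest_sum_attained (fun i => y i ^+ 2) half_le_d.
have : (d./2 - #|A|)%:R * (sigma ^+ 2 / 36) <= \sum_(i in J) y i ^+ 2.
  apply: (@le_trans _ _ (\sum_(i in J :\: A) y i ^+ 2)); last first.
    rewrite [leRHS](big_setID A)/= lerDr sumr_ge0// => i _; exact: sqr_ge0.
  apply: (@le_trans _ _ (\sum_(i in J :\: A) sigma ^+ 2 / 36)); last first.
    apply: ler_sum => i; rewrite !inE -ltNge => /andP[h _].
    by rewrite ler_pdivrMr// mulrC ltW.
  rewrite sumr_const mulr_natl ler_wpMn2l ?divr_ge0 ?sqr_ge0//.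
  by rewrite cardsD -cJ leq_sub2l// subset_leq_card// subsetIr.
have kA : (4 * d./2 <= 9 * (d./2 - #|A|))%N by lia.
have k0 : (0 < d./2)%N by lia.
have k0' : 0 < (d./2)%:R :> R by rewrite ltr0n.
have kA' : 4 * (d./2)%:R <= 9 * (d./2 - #|A|)%:R :> R by rewrite -!natrM ler_nat.
move=> h; rewrite mulrA -mulrA (mulrA 81) mulrAC ler_pdivlMr//.
have : 4 * (d./2)%:R * sigma ^+ 2 <= 9 * (d./2 - #|A|)%:R * sigma ^+ 2.
  by rewrite ler_wpM2r ?sqr_ge0.
lra.
Qed.

Context (theta : 'I_d -> R) (sigma : R) (s : nat).
Hypotheses (sigma0 : 0 < sigma) (theta_s : @sparse_vectors R d s theta).
Hypothesis sd : s%:R < d%:R / 2 :> R.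

Definition obs x : 'I_d -> R := fun j => theta j + sigma * x j.

Lemma two_s_lt_d : (2 * s < d)%N.
Proof. by rewrite -(@ltr_nat R) natrM; move: sd; lra. Qed.

Definition supp : {set 'I_d} := [set i | theta i != 0]%SET.

Lemma card_supp : (#|supp| <= s)%N. Proof. exact: theta_s. Qed.

Lemma theta_off i : i \notin supp -> theta i = 0.
Proof. by rewrite inE negbK => /eqP. Qed.

Lemma obs_flip_sqr k x i : k \notin supp -> obs (flip k x) i ^+ 2 = obs x i ^+ 2.
Proof.
move=> ks; rewrite /obs; case: (eqVneq i k) => [->|ik]; last by rewrite flip_neq.
by rewrite flip_eq theta_off// !add0r mulrN sqrrN.
Qed.

Lemma measurable_obs i : measurable_fun setT (fun x => obs x i).
Proof.
apply: measurable_funD => //; apply: measurable_funM => //.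
exact: measurable_coord.
Qed.

Lemma measurable_sigma_hat : measurable_fun setT (fun x => sigma_hat (obs x)).
Proof.
apply: measurable_funM => //.
apply: (measurableT_comp (continuous_measurable_fun (@sqrt_continuous R)));
  apply: measurable_funM => //.
apply: (measurable_smallest_sum (f := fun i x => obs x i ^+ 2) half_le_d).
  by move=> i; apply: measurable_funX; exact: measurable_obs.
by move=> i x; exact: sqr_ge0.
Qed.

(** Since 2 s < d, the complement of the support has at least [d./2] indices, and there y_i = sigma
    x_i; its sum of squares dominates that of the smallest ones. The constant is 81 * 3, from d <= 3
    [d./2]. *)
Lemma sigma_hat_upper x : (3 <= d)%N ->
  sigma_hat (obs x) ^+ 2 <= 243 * sigma ^+ 2 * (d%:R^-1 * \sum_(i < d) x i ^+ 2).
Proof.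
move=> d3; rewrite sigma_hat_sqr.
have k0 : 0 < (d./2)%:R :> R by rewrite ltr0n; lia.
have d0 : 0 < d%:R :> R by rewrite ltr0n; lia.
have dk : d%:R <= 3 * (d./2)%:R :> R by rewrite -natrM ler_nat; lia.
have kinv : (d./2)%:R^-1 <= 3 * d%:R^-1 :> R.
  by rewrite -[leLHS]mul1r ler_pdivrMr// mulrAC ler_pdivlMr// mul1r.
have : smallest_sum (fun i => obs x i ^+ 2) d./2 <= sigma ^+ 2 * \sum_(i < d) x i ^+ 2.
  apply: (@le_trans _ _ (\sum_(i in ~: supp) obs x i ^+ 2)).
    apply: smallest_sum_le; first by move=> i; exact: sqr_ge0.
    have := cardsC supp; have := card_supp; have := two_s_lt_d; rewrite card_ord; lia.
  rewrite mulr_sumr big_mkcond /=; apply: ler_sum => i _; rewrite inE.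
  case: ifPn => [/theta_off h|_]; last by rewrite mulr_ge0 ?sqr_ge0.
  by rewrite /obs h add0r exprMn.
have S0 : 0 <= sigma ^+ 2 * \sum_(i < d) x i ^+ 2.
  by rewrite mulr_ge0 ?sqr_ge0 ?sumr_ge0// => i _; exact: sqr_ge0.
move=> h.
have h1 : (d./2)%:R^-1 * smallest_sum (fun i => obs x i ^+ 2) d./2 <=
    (3 * d%:R^-1) * (sigma ^+ 2 * \sum_(i < d) x i ^+ 2).
  apply: ler_pM => //.
  by apply: smallest_sum_ge0 half_le_d _ => i; exact: sqr_ge0.
apply: (le_trans (ler_wpM2l _ h1)) => //.
rewrite le_eqVlt; apply/orP; left; apply/eqP; ring.
Qed.

End SigmaHat.

(** * Moments *)

Section Moments.
Context (R : realType) (d : nat) (disp : measure_display) (T : measurableType disp).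
Context (P : probability T R) (xi : 'I_d -> {RV P >-> R}).
Hypothesis xi_iid : iid_standard_normal xi.

Lemma sqr_le_cosh (u : R) : u ^+ 2 <= 2 * (expR u + expR (- u)).
Proof.
wlog u0 : u / 0 <= u => [h|].
  by have [/h//|/ltW] := leP 0 u; rewrite -oppr_ge0 => /h; rewrite sqrrN opprK addrC.
have := expR_ge1Dxn 1 u0; rewrite (_ : 2`! = 2)%N//.
have := expR_ge0 (- u); lra.
Qed.

Lemma pow4_le_cosh (u : R) : u ^+ 4 <= 24 * (expR u + expR (- u)).
Proof.
wlog u0 : u / 0 <= u => [h|].
  have [/h//|/ltW] := leP 0 u; rewrite -oppr_ge0 => /h.
  by rewrite (_ : (- u) ^+ 4 = u ^+ 4) ?opprK 1?addrC//; ring.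
have := expR_ge1Dxn 3 u0; rewrite (_ : 4`! = 24)%N//.
have := expR_ge0 (- u); lra.
Qed.

Lemma sqr_sum_le (I : finType) (A : {pred I}) (a : I -> R) :
  (\sum_(i in A) a i) ^+ 2 <= #|A|%:R * \sum_(i in A) a i ^+ 2.
Proof.
set S := \sum_(i in A) a i; set N : R := #|A|%:R.
have [A0|A0] := posnP #|A|.
  rewrite /S /N A0 mul0r big_pred0 ?expr0n// => i.
  by apply: (fintype.card0_eq A0).
have N0 : 0 < N by rewrite ltr0n.
have : 0 <= \sum_(i in A) (a i - S / N) ^+ 2 by apply: sumr_ge0 => i _; exact: sqr_ge0.
rewrite (eq_bigr (fun i => a i ^+ 2 - 2 * (S / N) * a i + (S / N) ^+ 2)); last first.
  by move=> i _; ring.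
rewrite big_split /= sumrB -mulr_sumr -/S sumr_const.
rewrite -[(S / N) ^+ 2 *+ _]mulr_natl -/N => /(mulr_ge0 (ltW N0)).
have -> : N * (\sum_(i in A) a i ^+ 2 - 2 * (S / N) * S + N * (S / N) ^+ 2) =
   N * \sum_(i in A) a i ^+ 2 - S ^+ 2 by field; rewrite gt_eqF.
by rewrite subr_ge0.
Qed.

Lemma exp_le_sqr i : exp_le xi (fun x => x i ^+ 2) 6.
Proof.
have := exp_leZ (a := 4) (ler0n _ _) (exp_le_exp_sq xi_iid i).
apply: exp_leW => [x|]; last by lra.
have := expR_ge1Dx (x i ^+ 2 / 4); lra.
Qed.

Lemma exp_le_pow4 i : exp_le xi (fun x => x i ^+ 4) 48.
Proof.
have := exp_leZ (a := 32) (ler0n _ _) (exp_le_exp_sq xi_iid i).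
apply: exp_leW => [x|]; last by lra.
have u0 : 0 <= x i ^+ 2 / 4 by rewrite divr_ge0 ?sqr_ge0.
have := expR_ge1Dxn 1 u0; rewrite (_ : 2`! = 2)%N//.
have -> : (x i ^+ 2 / 4) ^+ 2 = x i ^+ 4 / 16 by field.
lra.
Qed.

(** The Laplace transform of the sum, taken at plus and minus d^(-1/2) with every coordinate
    selected and t = 0, is at most exp 6; d >= 4 gives lam^2 <= 1/4. *)
Lemma exp_le_sum_pow4 : (4 <= d)%N ->
  exp_le xi (fun x => (\sum_(i < d) x i) ^+ 4) (48 * d%:R ^+ 2 * expR 6).
Proof.
move=> d4; have d0 : 0 < d%:R :> R by rewrite ltr0n; lia.
pose lam : R := (Num.sqrt d%:R)^-1.
have lam2 : lam ^+ 2 = d%:R^-1 by rewrite exprVn sqr_sqrtr// ltW.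
have mgf l : l ^+ 2 = d%:R^-1 -> exp_le xi (fun x => expR (l * \sum_(i < d) x i)) (expR 6).
  move=> l2.
  have := @exp_le_mgf _ _ _ _ _ _ xi_iid (index_enum 'I_d) (fun _ _ => true)
    (fun=> true) l 0 (index_enum_uniq _) _ _ _ _ _ _.
  move=> h; apply: exp_leW (h _ _ _ _ _ _) => //.
  - by move=> x; rewrite mul1r; under [in leRHS]eq_bigr do rewrite mulr1.
  - by rewrite l2 mul0r oppr0 expR0 mulr1 -mulrA mulVf ?mulr1// gt_eqF.
  - by move=> i x _ _ _; exact: sqr_ge0.
  - by rewrite l2 lef_pV2 ?posrE// ler_nat.
have h1 := mgf lam lam2.
have h2 : exp_le xi (fun x => expR (- lam * \sum_(i < d) x i)) (expR 6).
  by apply: mgf; rewrite sqrrN.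
have := exp_leZ (a := 24 * d%:R ^+ 2) _ (exp_leD h1 h2).
move=> h; apply: exp_leW (h _) => [x||]; last 2 first.
- by rewrite le_eqVlt; apply/orP; left; apply/eqP; ring.
- by rewrite mulr_ge0 ?sqr_ge0.
have := pow4_le_cosh (lam * \sum_(i < d) x i); rewrite -mulNr.
have -> : (lam * \sum_(i < d) x i) ^+ 4 = (lam ^+ 2) ^+ 2 * (\sum_(i < d) x i) ^+ 4 by ring.
rewrite lam2 exprVn mulrC ler_pdivrMr ?exprn_gt0// => h3.
by apply: (le_trans h3); rewrite le_eqVlt; apply/orP; left; apply/eqP; ring.
Qed.

(* Chernoff bound for the number of i with |y_i| <= sigma / 6: each has
   probability at most 1/6, so E 2^# <= (7/6)^d, against 2^(d/4). *)
Definition good_rate : R := ln 2 / 4 - ln (7 / 6).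

Lemma good_rate_gt0 : 0 < good_rate.
Proof.
rewrite /good_rate subr_gt0 ltr_pdivlMr// mulr_natr -lnXn; last by lra.
by rewrite ltr_ln ?posrE; lra.
Qed.

Context (theta : 'I_d -> R) (sigma : R) (s : nat).
Hypotheses (sigma0 : 0 < sigma) (theta_s : @sparse_vectors R d s theta).
Hypothesis sd : s%:R < d%:R / 2 :> R.
Notation obs := (obs theta sigma).

Definition good (x : vec R d) : bool := sigma <= sigma_hat (obs x).

Lemma exp_le_not_good : (10 <= d)%N ->
  exp_le xi (fun x => (~~ good x)%:R) (expR (- good_rate * d%:R)).
Proof.
move=> d10.
have sqr_le1 (a : R) : (a ^+ 2 <= 1) = (-1 <= a <= 1).
  by apply/idP/idP => [h|/andP[]]; [apply/andP; split; nra | nra].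
pose I i u := 36 * (theta i + sigma * u) ^+ 2 <= sigma ^+ 2.
pose g i u : R := 1 + (I i u)%:R.
(* Whatever the mean theta_i, the condition on the noise is an interval of length 1/3, hence of
   probability at most 1/6. *)
have IE i : (fun u => (I i u)%:R : R) =
    \1_(`[- (1 / 6) - theta i / sigma, 1 / 6 - theta i / sigma]%classic).
  apply/funext => u; rewrite indicE; congr (nat_of_bool _)%:R.
  rewrite mem_setE /I in_itv /=.
  have -> : 36 * (theta i + sigma * u) ^+ 2 = sigma ^+ 2 * (6 * (theta i / sigma + u)) ^+ 2.
    by field; rewrite gt_eqF.
  rewrite -[leRHS]mulr1 ler_pM2l ?exprn_gt0// sqr_le1.
  by apply/idP/idP; lra.
have mI i : measurable_fun setT (fun u => (I i u)%:R : R).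
  by rewrite IE; exact: measurable_indic.
have mg i : measurable_fun setT (g i) by exact: measurable_funD.
have g0 i u : 0 <= g i u by rewrite addr_ge0.
have Eg i : (\int[normal_prob 0 1]_u (g i u)%:E <= (7 / 6)%:E)%E.
  rewrite /g; under eq_integral do rewrite EFinD.
  rewrite ge0_integralD//=; last by apply/measurable_EFinP; exact: mI.
  rewrite integral_cst//= probability_setT mule1.
  have -> : (\int[normal_prob 0 1]_u ((I i u)%:R)%:E =
      \int[normal_prob 0 1]_u (\1_(`[- (1 / 6) - theta i / sigma, 1 / 6 - theta i /
        sigma]%classic) u)%:E)%E.
    by apply: eq_integral => u _; rewrite -(congr1 (@^~ u) (IE i)).
  rewrite integral_indic//= setIT.
  have := @normal_prob_itv_le R (- (1 / 6) - theta i / sigma) (1 / 6 - theta i / sigma).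
  move=> h; have {}h := h _.
  apply: (@le_trans _ _ (1%:E + ((1 / 6 - theta i / sigma - (- (1 / 6) - theta i /
    sigma)) / 2)%:E)%E).
    by rewrite leeD2l// h//; lra.
  by rewrite -EFinD lee_fin; lra.
have := exp_le_prod xi_iid (enum_uniq 'I_d) mg g0 Eg.
rewrite big_const_seq count_predT iter_mulr_1 size_enum_ord => h.
have := exp_leZ (a := expR (- (ln 2 / 4) * d%:R)) (expR_ge0 _) h.
apply: exp_leW => [x|]; last first.
  rewrite -[X in X ^+ d](lnK (x := 7 / 6)) ?posrE; last by lra.
  rewrite -expRM_natl -expRD le_eqVlt; apply/orP; left; apply/eqP; congr expR.
  rewrite /good_rate; ring.
have prodE : \prod_(i <- enum 'I_d) g i (x i) =
    expR (ln 2 * #|[set i | (36 * obs x i ^+ 2 <= sigma ^+ 2)%R]%SET|%:R).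
  rewrite mulrC expRM_natl lnK ?posrE// big_enum /= -prodr_const.
  rewrite [RHS]big_mkcond /=; apply: eq_bigr => i _.
  by rewrite /g /I inE /obs; case: (36 * _ <= _); rewrite ?addr0.
rewrite prodE -expRD.
case: (boolP (good x)) => /= [_|]; first exact: expR_ge0.
move=> bad; rewrite -[leLHS]expR0 ler_expR.
have : (d < 4 * #|[set i | (36 * obs x i ^+ 2 <= sigma ^+ 2)%R]%SET|)%N.
  by rewrite ltnNge; apply: contra bad; exact: sigma_hat_lower.
set n := #|_|; move=> /ltnW; rewrite -(@ler_nat R) natrM.
have : 0 <= ln 2 :> R by rewrite ln_ge0// ler1n.
move=> /ler_wpM2l/[apply]; lra.
Qed.

Lemma exp_le_sigma_hat2 : (3 <= d)%N ->
  exp_le xi (fun x => sigma_hat (obs x) ^+ 2) (1458 * sigma ^+ 2).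
Proof.
move=> d3; have d0 : 0 < d%:R :> R by rewrite ltr0n; lia.
have a0 : 0 <= 243 * sigma ^+ 2 / d%:R.
  by apply: divr_ge0; [exact: (mulr_ge0 (ler0n R 243) (sqr_ge0 sigma)) | exact: ltW].
apply: exp_leW (exp_leZ a0 (exp_le_sum (index_enum 'I_d) exp_le_sqr)) => [x|].
- have h1 := sigma_hat_upper sigma0 theta_s sd x d3.
  by apply: (le_trans h1); rewrite mulrA.
- rewrite sumr_const card_ord -mulr_natl.
  by rewrite le_eqVlt; apply/orP; left; apply/eqP; field; rewrite gt_eqF.
Qed.

Lemma exp_le_sigma_hat4 : (3 <= d)%N ->
  exp_le xi (fun x => sigma_hat (obs x) ^+ 4) (243 ^+ 2 * 48 * sigma ^+ 4).
Proof.
move=> d3; have d0 : 0 < d%:R :> R by rewrite ltr0n; lia.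
set c := 243 * sigma ^+ 2.
have a0 : 0 <= c ^+ 2 / d%:R by apply: divr_ge0; [exact: sqr_ge0 | exact: ltW].
apply: exp_leW (exp_leZ a0 (exp_le_sum (index_enum 'I_d) exp_le_pow4)) => [x|].
  have upper := sigma_hat_upper sigma0 theta_s sd x d3.
  have -> : sigma_hat (obs x) ^+ 4 = (sigma_hat (obs x) ^+ 2) ^+ 2 by ring.
  apply: (@le_trans _ _ ((c * (d%:R^-1 * \sum_(i < d) x i ^+ 2)) ^+ 2)).
    have h0 := sqr_ge0 (sigma_hat (obs x)).
    by rewrite lerXn2r ?nnegrE ?h0 ?(le_trans h0 upper).
  have h2 : (\sum_(i < d) x i ^+ 2) ^+ 2 <= d%:R * \sum_(i < d) x i ^+ 4.
    have := sqr_sum_le 'I_d (fun i => x i ^+ 2); rewrite card_ord.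
    by under [X in _ <= _ * X -> _]eq_bigr do rewrite -exprM.
  have -> : (c * (d%:R^-1 * \sum_(i < d) x i ^+ 2)) ^+ 2 =
    (c / d%:R) ^+ 2 * (\sum_(i < d) x i ^+ 2) ^+ 2 by ring.
  apply: (le_trans (ler_wpM2l (sqr_ge0 _) h2)).
  by rewrite le_eqVlt; apply/orP; left; apply/eqP; field; rewrite gt_eqF.
rewrite sumr_const card_ord -(mulr_natl 48 d) /c.
by rewrite le_eqVlt; apply/orP; left; apply/eqP; field; rewrite gt_eqF.
Qed.

End Moments.

(** * The logarithmic rate *)

Section LogFactor.
Context (R : realType).
Implicit Types (u v t : R).

Lemma ln_le_sub1 t : 0 < t -> ln t <= t - 1.
Proof.
by move=> t0; rewrite lerBrDr addrC -[leRHS](lnK (x := t)) ?posrE// expR_ge1Dx.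
Qed.

Lemma ln_le_half t : 0 < t -> ln t <= t / 2.
Proof.
move=> t0; have -> : ln t = ln (t / 2) + ln 2.
  by rewrite -lnM ?posrE ?divr_gt0// divfK.
have := @ln_le_sub1 (t / 2); have := @ln_le_sub1 2; rewrite divr_gt0//; lra.
Qed.

Lemma ln3_ge1 : 1 <= ln 3 :> R.
Proof.
(* Sixth powers give exp (-1) >= (5/6)^6 >= 1/3, that is e <= 3. *)
have h : 5 / 6 <= expR (- (1 / 6)) :> R by have := expR_ge1Dx (- (1 / 6) : R); lra.
have : 1 <= 3 * expR (- 1) :> R.
  have -> : expR (- 1) = expR (- (1 / 6)) ^+ 6 :> R by rewrite -expRM_natl; congr expR; lra.
  have : (5 / 6) ^+ 6 <= expR (- (1 / 6)) ^+ 6 :> R by rewrite lerXn2r ?nnegrE ?expR_ge0//; lra.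
  lra.
move=> h3; rewrite -[leLHS](expRK) ler_ln ?posrE ?expR_gt0//.
have : expR 1 * 1 <= expR 1 * (3 * expR (-1)) :> R by rewrite ler_wpM2l ?expR_ge0.
by rewrite mulr1 mulrCA -expRD subrr expR0 mulr1.
Qed.

(** With th = u / v the chord bound is Bernoulli's inequality (1 + N/u)^th <= 1 + th N/u = 1 + N/v;
    take logarithms and multiply by v. *)
Lemma mul_ln_mono (N u v : R) : 0 <= N -> 0 < u -> u <= v ->
  u * ln (1 + N / u) <= v * ln (1 + N / v).
Proof.
move=> N0 u0 uv; have v0 := lt_le_trans u0 uv.
have k01 : 0 <= u / v <= 1 by apply/andP; split;
  [rewrite divr_ge0// ltW | rewrite ler_pdivrMr// mul1r].
have Nu0 : 0 <= N / u by rewrite divr_ge0// ltW.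
have h := expR_chord_le (ln (1 + N / u)) k01.
rewrite lnK ?posrE ?ltr_wpDr// in h.
have -> : v * ln (1 + N / v) = v * ln (1 - u / v + u / v * (1 + N / u)).
  by congr (_ * ln _); field; rewrite !gt_eqF.
have -> : u * ln (1 + N / u) = v * (u / v * ln (1 + N / u)) by field; rewrite gt_eqF.
rewrite ler_pM2l// -[leLHS]expRK ler_ln ?posrE ?expR_gt0//.
exact: lt_le_trans (expR_gt0 _) h.
Qed.

Context (d : nat).
Notation N := (d%:R * ln d%:R : R).
Notation lf := (log_factor R d).
Hypothesis d3 : (3 <= d)%N.

Lemma ln_d_ge1 : 1 <= ln d%:R :> R.
Proof. by apply: (le_trans ln3_ge1); rewrite ler_ln ?posrE ?ltr0n ?ler_nat//; lia. Qed.

Let d0 : 0 < d%:R :> R. Proof. by rewrite ltr0n; lia. Qed.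

Lemma N_ge_d : d%:R <= N.
Proof. by rewrite -[leLHS]mulr1 ler_pM2l// ln_d_ge1. Qed.

Lemma N_gt0 : 0 < N.
Proof. exact: lt_le_trans d0 N_ge_d. Qed.

Definition log_rate (s : nat) : R := s%:R ^+ 2 * lf s.

Let sq_gt0 s : (0 < s)%N -> 0 < s%:R ^+ 2 :> R.
Proof. by move=> s0; rewrite exprn_gt0// ltr0n. Qed.

Lemma log_factor_ge0 s : (0 < s)%N -> 0 <= lf s.
Proof.
by move=> s0; rewrite ln_ge0// lerDl divr_ge0 ?(ltW N_gt0)// ltW ?sq_gt0.
Qed.

Lemma log_rate_ge0 s : 0 <= log_rate s.
Proof.
case: s => [|s]; first by rewrite /log_rate expr0n mul0r.
by rewrite mulr_ge0 ?sqr_ge0// log_factor_ge0.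
Qed.

Lemma log_rate_mono s s' : (0 < s)%N -> (s <= s')%N -> log_rate s <= log_rate s'.
Proof.
move=> s0 ss'; apply: mul_ln_mono; [exact/ltW/N_gt0 | exact: sq_gt0 |].
by rewrite lerXn2r ?nnegrE// ler_nat.
Qed.

Lemma log_factor_anti s s' : (0 < s)%N -> (s <= s')%N -> lf s' <= lf s.
Proof.
move=> s0 ss'; have s'0 := leq_trans s0 ss'; rewrite /log_factor.
have p n : (0 < n)%N -> 0 < 1 + N / n%:R ^+ 2.
  by move=> n0; rewrite ltr_wpDr// divr_ge0 ?(ltW N_gt0)// ltW ?sq_gt0.
rewrite ler_ln ?posrE ?p// lerD2l ler_pM2l ?N_gt0//.
by rewrite lef_pV2 ?posrE ?sq_gt0// lerXn2r ?nnegrE// ler_nat.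
Qed.

Lemma log_rate_ge_ln s : (0 < s)%N -> ln d%:R <= log_rate s.
Proof.
move=> s0; apply: le_trans (log_rate_mono (ltn0Sn 0) s0).
rewrite /log_rate /log_factor expr1n mul1r divr1 ler_ln ?posrE//.
  by have := N_ge_d; lra.
by have := N_gt0; lra.
Qed.

Lemma log_rate_le_N s : (0 < s)%N -> log_rate s <= N.
Proof.
move=> s0; have p : 0 < N / s%:R ^+ 2 by rewrite divr_gt0 ?N_gt0 ?sq_gt0.
have := @ln_le_sub1 (1 + N / s%:R ^+ 2); rewrite addr_gt0// => /(_ isT) h.
rewrite /log_rate mulrC -ler_pdivlMr ?sq_gt0//; move: h; rewrite /log_factor; lra.
Qed.

Lemma threshold_sq (s : nat) : (s%:R <= threshold_level R d) = (s%:R ^+ 2 <= N / 2).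
Proof.
have h : 0 <= N / 2 by rewrite divr_ge0 ?(ltW N_gt0).
by rewrite /threshold_level -{1}[s%:R]ger0_norm// -sqrtr_sqr ler_sqrt.
Qed.

Lemma log_factor_ge1 s : (0 < s)%N -> s%:R <= threshold_level R d -> 1 <= lf s.
Proof.
move=> s0; rewrite threshold_sq => h; apply: (le_trans ln3_ge1).
have p : 0 < s%:R ^+ 2 :> R by exact: sq_gt0.
have : 2 <= N / s%:R ^+ 2 by rewrite ler_pdivlMr//; lra.
rewrite /log_factor => h2; rewrite ler_ln ?posrE//; lra.
Qed.

(** At u = N / 2 the increasing function u ln (1 + N / u) equals (N / 2) ln 3, and ln 3 >= 1. *)
Lemma log_rate_ge_half s : threshold_level R d < s%:R -> N / 2 <= log_rate s.
Proof.
rewrite ltNge threshold_sq -ltNge => h; have N0 := N_gt0.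
have N20 : 0 < N / 2 by rewrite divr_gt0.
apply: (@le_trans _ _ (N / 2 * ln (1 + N / (N / 2)))).
  have -> : 1 + N / (N / 2) = 3.
    by rewrite invfM invrK mulrA divff ?gt_eqF// mul1r; lra.
  by rewrite ler_peMr ?ln3_ge1// ltW.
by apply: mul_ln_mono => //; exact: ltW.
Qed.

Lemma expRN_log_factor s : (0 < s)%N -> expR (- lf s) <= s%:R ^+ 2 / N.
Proof.
move=> s0; have p : 0 < s%:R ^+ 2 :> R by exact: sq_gt0.
have p2 : 0 < N / s%:R ^+ 2 by rewrite divr_gt0 ?N_gt0.
rewrite expRN lnK ?posrE ?addr_gt0// -[leRHS]invf_div lef_pV2 ?posrE ?addr_gt0//.
by rewrite lerDr.
Qed.

Lemma threshold_lt_d : threshold_level R d <= d%:R / 2.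
Proof.
rewrite /threshold_level -[leRHS]ger0_norm; last by rewrite divr_ge0 ?ltW.
rewrite -sqrtr_sqr ler_wsqrtr// expr_div_n.
have := ln_le_half d0 => /(ler_wpM2l (ltW d0)); lra.
Qed.

(** The first index at which the plain sum is used must be at most d, or [admissible] would not
    compare against it. *)
Lemma trunc_threshold_lt : ((Num.truncn (threshold_level R d)).+1 <= d)%N.
Proof.
have h : (Num.truncn (threshold_level R d))%:R <= d%:R / 2 :> R.
  by apply: le_trans threshold_lt_d; rewrite truncn_le// sqrtr_ge0.
by rewrite -(@ltr_nat R); have := d0; lra.
Qed.

End LogFactor.

(** * Tails of thresholded sums *)

Section Selection.
Context (R : realType) (d : nat) (disp : measure_display) (T : measurableType disp).
Context (P : probability T R) (xi : 'I_d -> {RV P >-> R}).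
Hypothesis xi_iid : iid_standard_normal xi.
Context (theta : 'I_d -> R) (sigma : R).
Hypothesis sigma0 : 0 < sigma.
Notation obs := (obs theta sigma).
Notation good := (good theta sigma).
Notation offsupp := (~: supp theta).
Implicit Types (lo hi lam t X : R) (top : bool) (x : vec R d).

(** A difference of two thresholded sums selects a band of squares; [top] removes the upper end,
    which covers a single thresholded sum. *)
Definition sel lo hi top x (j : 'I_d) : bool :=
  (lo * sigma_hat (obs x) ^+ 2 < obs x j ^+ 2) &&
  (top || (obs x j ^+ 2 <= hi * sigma_hat (obs x) ^+ 2)).

Definition selsum lo hi top x : R :=
  \sum_(j in offsupp) x j * (sel lo hi top x j)%:R.

Lemma measurable_natr_bool disp' (T' : measurableType disp') (b : T' -> bool) :
  measurable_fun setT b -> measurable_fun setT (fun w => (b w)%:R : R).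
Proof. by move=> mb; apply: (measurableT_comp (f := fun c : bool => c%:R : R)). Qed.

Lemma measurable_sigma_hat2 lo :
  measurable_fun setT (fun x => lo * sigma_hat (obs x) ^+ 2).
Proof.
by apply: measurable_funM => //; apply: measurable_funX; exact: measurable_sigma_hat.
Qed.

Lemma measurable_sel lo hi top j :
  measurable_fun setT (fun x => (sel lo hi top x j)%:R : R).
Proof.
have mo : measurable_fun setT (fun x => obs x j ^+ 2).
  by apply: measurable_funX; exact: measurable_obs.
apply: measurable_natr_bool; apply: measurable_and.
  by apply: measurable_fun_ltr => //; exact: measurable_sigma_hat2.
case: top => //=; apply: measurable_fun_ler => //; exact: measurable_sigma_hat2.
Qed.

Lemma measurable_good : measurable_fun setT (fun x => (good x)%:R : R).
Proof.
apply: measurable_natr_bool; apply: measurable_fun_ler => //.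
exact: measurable_sigma_hat.
Qed.

Lemma sigma_hat_flip k x : k \in offsupp ->
  sigma_hat (obs (flip k x)) = sigma_hat (obs x).
Proof.
by rewrite inE => ks; apply: eq_sigma_hat => i; exact: obs_flip_sqr.
Qed.

(** Off the support, sigma^2 x_i^2 = y_i^2 > lo sigma_hat^2 >= lo sigma^2 on [good]: the random
    level yields the deterministic bound required by [exp_le_mgf]. *)
Lemma sel_sqr_ge lo hi top x i : 0 <= lo -> i \in offsupp -> good x ->
  sel lo hi top x i -> lo <= x i ^+ 2.
Proof.
rewrite inE => lo0 /theta_off ti gx /andP[+ _].
rewrite {2}/obs ti add0r [ltRHS]exprMn => h1.
have s2 : 0 < sigma ^+ 2 by rewrite exprn_gt0.
have sh2 : sigma ^+ 2 <= sigma_hat (obs x) ^+ 2.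
  by rewrite lerXn2r ?nnegrE ?sigma_hat_ge0// ltW.
have h2 : lo * sigma ^+ 2 <= lo * sigma_hat (obs x) ^+ 2 by rewrite ler_wpM2l.
by rewrite -(ler_pM2r s2) [leRHS]mulrC ltW//; exact: le_lt_trans h2 h1.
Qed.

(** [t] is a deterministic lower bound for the selected squares: up to [lo] when [lo] is
    nonnegative, up to 0 for the level -1. The hypotheses of [exp_le_mgf] on flips hold because
    selection and [good] depend on squares only. *)
Lemma exp_le_selsum lo hi top lam t :
  (lo <= 0 -> t <= 0) -> (0 <= lo -> t <= lo) -> lam ^+ 2 <= 4^-1 ->
  exp_le xi (fun x => (good x)%:R * expR (lam * selsum lo hi top x))
    (expR (6 * lam ^+ 2 * d%:R * expR (- (t / 8)))).
Proof.
move=> tlo0 tlo lam4.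
have h := @exp_le_mgf _ _ _ _ _ _ xi_iid (enum offsupp)
  (fun j x => sel lo hi top x j) good lam t (enum_uniq _)
  (measurable_sel lo hi top) measurable_good.
apply: exp_leW (h _ _ _ _) => //.
- by move=> x; rewrite big_enum.
- by move=> k x; rewrite mem_enum => ks; rewrite /good sigma_hat_flip.
- move=> i k x; rewrite mem_enum => ks; rewrite /sel sigma_hat_flip//.
  by rewrite obs_flip_sqr//; move: ks; rewrite inE.
- move=> i x; rewrite mem_enum => ioff gx selx.
  have [lo0|lo0] := leP lo 0; first by apply: (le_trans (tlo0 lo0)); exact: sqr_ge0.
  apply: (le_trans (tlo (ltW lo0))).
  exact: sel_sqr_ge (ltW lo0) ioff gx selx.
Qed.

Lemma exp_le_selsum_tail lo hi top lam t X :
  (lo <= 0 -> t <= 0) -> (0 <= lo -> t <= lo) -> lam ^+ 2 <= 4^-1 -> 0 <= lam ->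
  exp_le xi (fun x => (good x && (X < `|selsum lo hi top x|))%:R)
    (2 * expR (6 * lam ^+ 2 * d%:R * expR (- (t / 8)) - lam * X)).
Proof.
move=> h1 h2 h3 lam0.
have p := exp_le_selsum hi top h1 h2 h3.
have n := @exp_le_selsum lo hi top (- lam) t h1 h2.
rewrite sqrrN in n; have {}n := n h3.
have := exp_leZ (a := expR (- (lam * X))) (expR_ge0 _) (exp_leD p n).
apply: exp_leW => [x|]; last first.
  by rewrite expRD le_eqVlt; apply/orP; left; apply/eqP; ring.
case: (good x) => /=; last by rewrite !mul0r addr0 mulr0.
rewrite !mul1r; case: ltP => [XT|_] /=; last by rewrite mulr_ge0 ?expR_ge0// addr_ge0 ?expR_ge0.
rewrite mulrDr -!expRD.
have [T0|T0] := leP 0 (selsum lo hi top x).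
  rewrite ger0_norm// in XT.
  have : 1 <= expR (- (lam * X) + lam * selsum lo hi top x).
    have h : lam * X <= lam * selsum lo hi top x by rewrite ler_wpM2l// ltW.
    by rewrite -[leLHS]expR0 ler_expR; lra.
  have := expR_ge0 (- (lam * X) + - lam * selsum lo hi top x); lra.
rewrite ltr0_norm// in XT.
have : 1 <= expR (- (lam * X) + - lam * selsum lo hi top x).
  have h : lam * X <= lam * - selsum lo hi top x by rewrite ler_wpM2l// ltW.
  by rewrite -[leLHS]expR0 ler_expR; lra.
have := expR_ge0 (- (lam * X) + lam * selsum lo hi top x); lra.
Qed.

End Selection.

(** * Admissibility *)

Section Admissibility.
Context (R : realType) (d : nat) (disp : measure_display) (T : measurableType disp).
Context (P : probability T R) (xi : 'I_d -> {RV P >-> R}).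
Hypothesis xi_iid : iid_standard_normal xi.
Context (theta : 'I_d -> R) (sigma : R) (s : nat) (alpha beta : R).
Hypotheses (sigma0 : 0 < sigma) (theta_s : @sparse_vectors R d s theta).
Hypotheses (sd : s%:R < d%:R / 2 :> R) (d10 : (10 <= d)%N) (s0 : (0 < s)%N).
Hypothesis alpha48 : 48 < alpha.
Hypothesis beta_ge : 16 / 9 * (Num.sqrt 12 + 2 * Num.sqrt alpha) ^+ 2 <= beta.
Notation obs := (obs theta sigma).
Notation good := (good theta sigma).
Notation offsupp := (~: supp theta).
Notation selsum := (selsum theta sigma).
Notation sel := (sel theta sigma).
Notation lf := (log_factor R d).
Notation q := (log_rate R d).
Notation N := (d%:R * ln d%:R : R).
Implicit Types (x : vec R d).

Let d3 : (3 <= d)%N. Proof. exact: leq_trans d10. Qed.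
Let d0 : 0 < d%:R :> R. Proof. by rewrite ltr0n (leq_trans _ d10). Qed.

Let alpha0 : 0 <= alpha. Proof. by apply: le_trans (ltW alpha48). Qed.

(** From sqrt 12 >= 3.4 and sqrt alpha >= 6.9: 4/3 * 3.4 + 5/3 * 6.9 > 16. *)
Lemma sqrt_beta_gap : 16 <= Num.sqrt beta - Num.sqrt alpha.
Proof.
have a0 := sqrtr_ge0 alpha; have t0 := sqrtr_ge0 (12 : R).
have b1 : 4 / 3 * (Num.sqrt 12 + 2 * Num.sqrt alpha) <= Num.sqrt beta.
  rewrite -[leLHS]ger0_norm; last by lra.
  rewrite -sqrtr_sqr ler_wsqrtr//; apply: le_trans beta_ge.
  by rewrite exprMn; lra.
have sqrt_lb (a b : R) : 0 <= a -> a ^+ 2 <= b -> a <= Num.sqrt b.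
  by move=> ha hab; rewrite -[leLHS]ger0_norm// -sqrtr_sqr ler_wsqrtr.
have h1 : 34 / 10 <= Num.sqrt 12 :> R by apply: sqrt_lb; lra.
have h2 : 69 / 10 <= Num.sqrt alpha by apply: sqrt_lb; have := alpha48; lra.
lra.
Qed.

Lemma beta_ge0 : 0 <= beta.
Proof. by apply: le_trans beta_ge; rewrite mulr_ge0// sqr_ge0. Qed.

(* On the event [good] every coordinate passes the level -1, which reproduces
   the plain sum used above [threshold_level]. *)
Definition lower_level (r : nat) : R :=
  if r%:R <= threshold_level R d then alpha * lf r else -1.

Lemma good_gt0 x : good x -> 0 < sigma_hat (obs x).
Proof. exact: lt_le_trans. Qed.

Lemma L_hat_atE r x : good x -> L_hat_at alpha (obs x) r =
  \sum_(j < d) obs x j * (lower_level r * sigma_hat (obs x) ^+ 2 < obs x j ^+ 2)%R%:R.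
Proof.
move=> gx; have h := good_gt0 gx; rewrite /L_hat_at /lower_level; case: ifP => _.
  rewrite big_mkcond /=; apply: eq_bigr => j _.
  by rewrite mulrAC; case: ifP; rewrite ?mulr1 ?mulr0.
apply: eq_bigr => j _; rewrite (_ : _ < _ = true) ?mulr1//.
have := sqr_ge0 (obs x j); have : 0 < sigma_hat (obs x) ^+ 2 by rewrite exprn_gt0.
lra.
Qed.

Lemma omegaE (y : 'I_d -> R) r : omega beta y r = Num.sqrt beta * sigma_hat y * Num.sqrt (q r).
Proof.
have b0 := beta_ge0; have h := sigma_hat_ge0 y.
rewrite /omega -(mulrA _ (r%:R ^+ 2)) sqrtrM ?mulr_ge0 ?sqr_ge0// sqrtrM//.
by rewrite sqrtr_sqr ger0_norm.
Qed.

Section Selected.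
Hypothesis s_small : s%:R <= threshold_level R d.

Lemma L_hat_at_diff r x : good x -> (s < r)%N ->
  L_hat_at alpha (obs x) r - L_hat_at alpha (obs x) s =
  \sum_(j < d) obs x j * (sel (lower_level r) (alpha * lf s) false x j)%:R.
Proof.
move=> gx sr; rewrite !L_hat_atE// -sumrB; apply: eq_bigr => j _.
rewrite -mulrBr; congr (_ * _); rewrite /sel /=.
have -> : lower_level s = alpha * lf s by rewrite /lower_level s_small.
have h : lower_level r * sigma_hat (obs x) ^+ 2 <= alpha * lf s * sigma_hat (obs x) ^+ 2.
  rewrite ler_wpM2r ?sqr_ge0// /lower_level; case: ifP => _.
    by rewrite ler_wpM2l// log_factor_anti// ltnW.
  by apply: (@le_trans _ _ 0); [lra | rewrite mulr_ge0// log_factor_ge0].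
by case: ltP => h1; case: ltP => h2 //=; rewrite ?subrr ?subr0//; lra.
Qed.

(** The selected coordinates in the support are at most s in number, each at most sqrt (alpha
    [lf s]) sigma_hat in absolute value, so they sum to at most sqrt alpha sigma_hat sqrt (q s) <=
    sqrt alpha sigma_hat sqrt (q r). With sigma <= sigma_hat on the noise part, sigma_hat cancels
    and the rest of sqrt beta falls on [selsum]. *)
Lemma not_admissible_selsum x : good x -> ~~ admissible alpha beta (obs x) s ->
  exists2 r, (s < r <= d)%N &
    16 * Num.sqrt (q r) < `|selsum (lower_level r) (alpha * lf s) false x|.
Proof.
move=> gx /allPn[r]; rewrite mem_index_iota ltnS => rr.
have /andP[sr rd] := rr; rewrite -ltNge distrC L_hat_at_diff// omegaE => big.
exists r => //; have shpos := good_gt0 gx.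
set a := sel _ _ _ x in big; set Tr := selsum _ _ _ x.
set sh := sigma_hat (obs x) in big shpos *.
have lf0 : 0 <= lf s by exact: log_factor_ge0.
have offE : \sum_(j < d) obs x j * (a j)%:R =
    \sum_(j in supp theta) obs x j * (a j)%:R + sigma * Tr.
  rewrite (bigID (mem (supp theta))) /=; congr (_ + _).
  rewrite /Tr /selsum mulr_sumr; apply: eq_big => [j|j js]; first by rewrite finset.in_setC.
  by rewrite /obs (theta_off js) add0r mulrA.
have onB : `|\sum_(j in supp theta) obs x j * (a j)%:R| <=
    Num.sqrt alpha * sh * Num.sqrt (q r).
  apply: (@le_trans _ _ (\sum_(j in supp theta) Num.sqrt (alpha * lf s) * sh)).
    apply: (le_trans (ler_norm_sum _ _ _)); apply: ler_sum => j _.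
    case: (boolP (a j)) => [|_]; last by rewrite mulr0 normr0 mulr_ge0 ?sqrtr_ge0 ?ltW.
    rewrite mulr1 => /andP[_ /= hj]; rewrite -(ger0_norm (ltW shpos)) -!sqrtr_sqr.
    by rewrite -sqrtrM ?mulr_ge0// ler_wsqrtr.
  have cq : #|supp theta|%:R * Num.sqrt (lf s) <= Num.sqrt (q r).
    apply: (@le_trans _ _ (Num.sqrt (q s))); last first.
      by rewrite ler_wsqrtr// log_rate_mono// ltnW.
    rewrite /log_rate sqrtrM ?sqr_ge0// sqrtr_sqr ger0_norm//.
    by rewrite ler_wpM2r ?sqrtr_ge0// ler_nat card_supp.
  rewrite sumr_const -mulr_natl sqrtrM//.
  have -> : #|supp theta|%:R * (Num.sqrt alpha * Num.sqrt (lf s) * sh) =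
    Num.sqrt alpha * sh * (#|supp theta|%:R * Num.sqrt (lf s)) by ring.
  by rewrite ler_wpM2l// mulr_ge0 ?sqrtr_ge0// ltW.
rewrite offE in big.
have : `|\sum_(j in supp theta) obs x j * (a j)%:R + sigma * Tr| <=
    Num.sqrt alpha * sh * Num.sqrt (q r) + sh * `|Tr|.
  apply: (le_trans (ler_normD _ _)); rewrite lerD// normrM (gtr0_norm sigma0).
  by rewrite ler_wpM2r.
move=> /(lt_le_trans big) h.
have gap : 16 * Num.sqrt (q r) <= (Num.sqrt beta - Num.sqrt alpha) * Num.sqrt (q r).
  by rewrite ler_wpM2r ?sqrtr_ge0// sqrt_beta_gap.
apply: (le_lt_trans gap); rewrite -(ltr_pM2l shpos); lra.
Qed.

End Selected.

Lemma expRN3_ln : expR (- (3 * ln d%:R)) = d%:R ^- 3 :> R.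
Proof. by rewrite expRN mulrC expRM_natr lnK ?posrE. Qed.

Lemma exp_le_tail_rate (lo hi t : R) top (r : nat) : (0 < r)%N ->
  (lo <= 0 -> t <= 0) -> (0 <= lo -> t <= lo) ->
  ln d%:R ^+ 2 <= 4 * q r ->
  3 / 8 * ln d%:R * (d%:R * expR (- (t / 8))) <= q r ->
  exp_le xi (fun x => (good x && (16 * Num.sqrt (q r) < `|selsum lo hi top x|))%:R)
    (2 * d%:R ^- 3).
Proof.
move=> r0 h1 h2 lnq expq.
have ln1 := ln_d_ge1 R d3.
have q0 : 0 < q r.
  have : 0 < ln d%:R ^+ 2 :> R by rewrite exprn_gt0//; lra.
  lra.
have sq0 : 0 < Num.sqrt (q r) by rewrite sqrtr_gt0.
have sq2 : Num.sqrt (q r) ^+ 2 = q r by rewrite sqr_sqrtr// ltW.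
(* With this choice lam * 16 sqrt (q r) = 4 ln d, while the last hypothesis keeps the variance term
   below ln d: the exponent is at most - 3 ln d. The hypothesis on (ln d)^2 is exactly lam <=
   1/2. *)
pose lam := ln d%:R / (4 * Num.sqrt (q r)).
have lam2 : lam ^+ 2 = ln d%:R ^+ 2 / (16 * q r).
  by rewrite /lam -[in RHS]sq2; field; rewrite gt_eqF.
have lam4 : lam ^+ 2 <= 4^-1.
  by rewrite lam2 ler_pdivrMr; [lra | rewrite pmulr_rgt0].
have lam0 : 0 <= lam by apply: divr_ge0; [lra | apply: mulr_ge0 => //; exact: ltW].
have tail := exp_le_selsum_tail xi_iid theta sigma0 hi top (16 * Num.sqrt (q r)) h1 h2
  lam4 lam0.
apply: exp_leW tail => //.
rewrite ler_pM2l// -expRN3_ln ler_expR.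
have -> : lam * (16 * Num.sqrt (q r)) = 4 * ln d%:R.
  by rewrite /lam; field; rewrite gt_eqF.
have -> : 6 * lam ^+ 2 * d%:R * expR (- (t / 8)) =
    (3 / 8 * ln d%:R * (d%:R * expR (- (t / 8)))) / q r * ln d%:R.
  by rewrite lam2; field; rewrite gt_eqF.
have : (3 / 8 * ln d%:R * (d%:R * expR (- (t / 8)))) / q r * ln d%:R <= 1 * ln d%:R.
  rewrite ler_wpM2r//; first by lra.
  by rewrite ler_pdivrMr// mul1r.
lra.
Qed.

(* For such small r, with high probability nothing is selected off the support.
   The exponential bound of [exp_le_tail_rate] needs [lam <= 1/2] and would only
   give exp (- C sqrt (ln d)) for bounded r. *)
Lemma exp_le_small_level (r : nat) top (hi : R) : (0 < r)%N -> r%:R <= threshold_level R d ->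
  r%:R ^+ 4 <= N ->
  exp_le xi (fun x => (good x && (16 * Num.sqrt (q r) <
      `|selsum (lower_level r) hi top x|))%:R) (2 * d%:R ^- 3).
Proof.
move=> r0 rt rN; rewrite /lower_level rt; set lo := alpha * lf r.
have lf1 := log_factor_ge1 d3 r0 rt.
have lo0 : 0 <= lo by apply: mulr_ge0 => //; lra.
have Nd := N_ge_d R d3; have N0 := N_gt0 R d3.
(* Union bound in exponential form: a selected j off the support has x_j^2 >= lo, and its term alone
   makes exp (- lo / 4) sum_i exp (x_i^2 / 4) at least 1. *)
have := exp_leZ (a := expR (- (lo / 4))) (expR_ge0 _)
  (exp_le_sum (index_enum 'I_d) (exp_le_exp_sq xi_iid)).
apply: exp_leW => [x|].
  case: (boolP (good x)) => gx /=; last first.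
    by rewrite mulr_ge0 ?expR_ge0 ?sumr_ge0// => i _; exact: expR_ge0.
  have sum0 : 0 <= \sum_(i < d) expR (x i ^+ 2 / 4) :> R.
    by apply: sumr_ge0 => i _; exact: expR_ge0.
  case: ltP => [big|_] /=; last by rewrite mulr_ge0 ?expR_ge0.
  have [j joff selj] : exists2 j, j \in offsupp & sel lo hi top x j.
    apply: contrapT => none; move: big; rewrite ltNge => /negP; apply.
    rewrite /selsum big1 ?normr0 ?mulr_ge0 ?sqrtr_ge0// => j js.
    case: (boolP (sel lo hi top x j)) => [sj|_]; last by rewrite mulr0.
    by exfalso; apply: none; exists j.
  have xj := sel_sqr_ge sigma0 lo0 joff gx selj.
  rewrite (bigD1 j)//= mulrDr -expRD.
  apply: (@le_trans _ _ (expR (- (lo / 4) + x j ^+ 2 / 4))).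
    by rewrite -[leLHS]expR0 ler_expR; lra.
  rewrite lerDl mulr_ge0 ?expR_ge0// sumr_ge0// => i _; exact: expR_ge0.
rewrite sumr_const card_ord -(mulr_natl (3 / 2)).
(* This is where 48 = 4 * 12 enters. As exp (- [lf r]) <= r^2 / N and r^4 <= N, its square is at
   most 1 / N, so the twelfth power is at most N^-6 <= d^-6. *)
have e12 : expR (- (lo / 4)) <= expR (- lf r) ^+ 12.
  rewrite -expRM_natl ler_expR /lo.
  have : 48 * lf r <= alpha * lf r by rewrite ler_wpM2r ?ltW//; lra.
  lra.
have := expRN_log_factor R d3 r0; set e := expR (- lf r) => eN.
have e0 : 0 <= e by exact: expR_ge0.
have e2 : e ^+ 2 <= N^-1.
  apply: (@le_trans _ _ ((r%:R ^+ 2 / N) ^+ 2)).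
    by rewrite lerXn2r ?nnegrE// divr_ge0 ?sqr_ge0// ltW.
  rewrite expr_div_n -exprM ler_pdivrMr ?exprn_gt0// expr2 mulrA mulVf ?gt_eqF// mul1r//.
have e12d : e ^+ 12 <= d%:R ^- 6.
  rewrite (_ : 12 = 2 * 6)%N// exprM.
  apply: (@le_trans _ _ (N^-1 ^+ 6)).
    by rewrite lerXn2r ?nnegrE ?sqr_ge0// invr_ge0 ltW.
  by rewrite exprVn lef_pV2 ?posrE ?exprn_gt0// lerXn2r ?nnegrE ?(ltW d0) ?(ltW N0).
have d1 : 1 <= d%:R :> R by rewrite ler1n (leq_trans _ d10).
apply: (@le_trans _ _ (d%:R ^- 6 * (d%:R * (3 / 2)))).
  by rewrite ler_wpM2r ?mulr_ge0// (le_trans e12).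
have -> : d%:R ^- 6 * (d%:R * (3 / 2)) = d%:R ^- 3 * (3 / 2 * d%:R ^- 2) :> R.
  by field; rewrite gt_eqF.
rewrite [leRHS]mulrC ler_wpM2l ?invr_ge0 ?exprn_ge0//.
have : d%:R ^- 2 <= 1 :> R by rewrite invf_le1 ?exprn_gt0// exprn_ege1.
lra.
Qed.

(** For r^4 > N below the threshold, ln d <= 4 ln r <= 2 r and q r >= r^2 give lam <= 1/2, and exp
    (- [lf r]) <= r^2 / N bounds the variance term by 3/8 r^2. Above the threshold t = 0 and q r >=
    N / 2 exceeds 3/8 N. *)
Lemma exp_le_selsum_level (r : nat) top (hi : R) : (0 < r)%N ->
  exp_le xi (fun x => (good x && (16 * Num.sqrt (q r) <
      `|selsum (lower_level r) hi top x|))%:R) (2 * d%:R ^- 3).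
Proof.
move=> r0.
have ln1 := ln_d_ge1 R d3; have Nd := N_ge_d R d3; have N0 := N_gt0 R d3.
have [rt|rt] := leP (r%:R : R) (threshold_level R d).
  have [rN|Nr] := leP (r%:R ^+ 4) N; first exact: exp_le_small_level.
  have lf1 := log_factor_ge1 d3 r0 rt.
  have rr0 : 0 < r%:R :> R by rewrite ltr0n.
  have qr : r%:R ^+ 2 <= q r by rewrite /log_rate ler_peMr ?sqr_ge0.
  have lo0 : 0 <= alpha * lf r by apply: mulr_ge0 => //; lra.
  rewrite /lower_level rt; apply: (@exp_le_tail_rate _ _ (alpha * lf r)) => //.
    have : ln d%:R <= 2 * r%:R :> R.
      apply: (@le_trans _ _ (ln (r%:R ^+ 4))).
        by rewrite ler_ln ?posrE ?exprn_gt0//; lra.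
      by rewrite lnXn// -(mulr_natl (ln _) 4); have := ln_le_half rr0; lra.
    move=> h; apply: (@le_trans _ _ ((2 * r%:R) ^+ 2)); last by rewrite exprMn; lra.
    by rewrite lerXn2r ?nnegrE ?mulr_ge0//; lra.
  have e1 : expR (- (alpha * lf r / 8)) <= r%:R ^+ 2 / N.
    apply: le_trans (expRN_log_factor R d3 r0); rewrite ler_expR.
    have : 48 * lf r <= alpha * lf r by rewrite ler_wpM2r ?ltW//; lra.
    lra.
  apply: (@le_trans _ _ (3 / 8 * ln d%:R * (d%:R * (r%:R ^+ 2 / N)))).
    apply: ler_wpM2l; first by lra.
    by apply: ler_wpM2l => //; exact: ltW.
  have -> : 3 / 8 * ln d%:R * (d%:R * (r%:R ^+ 2 / N)) = 3 / 8 * r%:R ^+ 2.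
    by field; rewrite !gt_eqF//; lra.
  have : 0 <= r%:R ^+ 2 :> R by exact: sqr_ge0.
  lra.
have qN := log_rate_ge_half d3 rt.
have nt : (r%:R <= threshold_level R d) = false by rewrite leNgt rt.
have h := ln_le_half d0.
have h2 : ln d%:R * ln d%:R <= d%:R / 2 * ln d%:R :> R by rewrite ler_wpM2r//; lra.
rewrite /lower_level nt; apply: (@exp_le_tail_rate _ _ 0) => //.
  by rewrite expr2; lra.
by rewrite mul0r oppr0 expR0 mulr1; lra.
Qed.


End Admissibility.

(** * Failure of admissibility and second moment of the selected noise *)

Section Risk.
Context (R : realType) (d : nat) (disp : measure_display) (T : measurableType disp).
Context (P : probability T R) (xi : 'I_d -> {RV P >-> R}).
Hypothesis xi_iid : iid_standard_normal xi.
Context (theta : 'I_d -> R) (sigma : R) (s : nat) (alpha beta : R).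
Hypotheses (sigma0 : 0 < sigma) (theta_s : @sparse_vectors R d s theta).
Hypotheses (sd : s%:R < d%:R / 2 :> R) (d10 : (10 <= d)%N) (s0 : (0 < s)%N).
Hypothesis alpha48 : 48 < alpha.
Hypothesis beta_ge : 16 / 9 * (Num.sqrt 12 + 2 * Num.sqrt alpha) ^+ 2 <= beta.
Notation obs := (obs theta sigma).
Notation good := (good theta sigma).
Notation offsupp := (~: supp theta).
Notation selsum := (selsum theta sigma).
Notation lf := (log_factor R d).
Notation q := (log_rate R d).
Notation N := (d%:R * ln d%:R : R).
Notation L := (linear_functional theta).
Implicit Types (x : vec R d).

Let d3 : (3 <= d)%N. Proof. exact: leq_trans d10. Qed.
Let d0 : 0 < d%:R :> R. Proof. by rewrite ltr0n (leq_trans _ d10). Qed.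
Let alpha0 : 0 <= alpha. Proof. by apply: le_trans (ltW alpha48). Qed.
Let ln1 : 1 <= ln d%:R :> R. Proof. exact: ln_d_ge1. Qed.

Definition bad_const : R := (4 / good_rate R) ^+ 4.

Lemma bad_const_ge0 : 0 <= bad_const.
Proof. by rewrite exprn_ge0// divr_ge0// ltW// good_rate_gt0. Qed.

(** From exp u >= u at u = k d / 4, raised to the fourth power. The rate d^-4 is what
    [exp_le_selsum_sq] consumes. *)
Lemma exp_le_bad : exp_le xi (fun x => (~~ good x)%:R) (bad_const * d%:R ^- 4).
Proof.
apply: exp_leW (exp_le_not_good xi_iid theta sigma0 d10) => //.
have k0 := good_rate_gt0 R; set k := good_rate R in k0 *.
have h : (k * d%:R / 4) ^+ 4 <= expR (k * d%:R).
  have -> : expR (k * d%:R) = expR (k * d%:R / 4) ^+ 4.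
    by rewrite -expRM_natl; congr expR; field.
  have p : 0 <= k * d%:R / 4 by rewrite divr_ge0// mulr_ge0// ltW.
  rewrite lerXn2r ?nnegrE ?expR_ge0//.
  by have := expR_ge1Dx (k * d%:R / 4); lra.
rewrite mulNr expRN /bad_const -/k.
have -> : (4 / k) ^+ 4 * d%:R ^- 4 = ((k * d%:R / 4) ^+ 4)^-1.
  by field; rewrite !gt_eqF.
by rewrite lef_pV2 ?posrE ?expR_gt0// exprn_gt0// divr_gt0// mulr_gt0.
Qed.

Section Sparse.
Hypothesis s_small : s%:R <= threshold_level R d.

Lemma exp_le_not_admissible :
  exp_le xi (fun x => (~~ admissible alpha beta (obs x) s)%:R)
    ((bad_const + 2) * d%:R ^- 2).
Proof.
have lev (i : 'I_d) := exp_le_selsum_level xi_iid theta sigma0 d10 alpha48 false (alpha *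
  lf s) (ltn0Sn i).
have := exp_leD exp_le_bad (exp_le_sum (index_enum 'I_d) lev).
apply: exp_leW => [x|].
  have sum0 : 0 <= \sum_(i < d) (good x && (16 * Num.sqrt (q i.+1) <
      `|selsum (lower_level d alpha i.+1) (alpha * lf s) false x|))%:R :> R.
    by apply: sumr_ge0.
  case: (boolP (good x)) => gx /=; last first.
    apply: (@le_trans _ _ 1); first by case: (~~ _).
    by rewrite lerDl; apply: sumr_ge0.
  rewrite add0r; case: (boolP (admissible _ _ _ _)) => /= [_|na]; first exact: sumr_ge0.
  have [r /andP[sr rd] big] := not_admissible_selsum sigma0 theta_s d10 s0 alpha48
    beta_ge s_small gx na.
  case: r sr rd big => // r sr rd big.
  rewrite (bigD1 (Ordinal rd))//= big /= lerDl; exact: sumr_ge0.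
rewrite sumr_const card_ord -(mulr_natl (2 * _) d).
have -> : d%:R * (2 * d%:R ^- 3) = 2 * d%:R ^- 2 :> R by field; rewrite gt_eqF.
rewrite [leRHS]mulrDl lerD2r ler_wpM2l ?bad_const_ge0//.
rewrite lef_pV2 ?posrE ?exprn_gt0// ler_weXn2l// ler1n (leq_trans _ d10)//.
Qed.

(** The support contributes 24 = 4 * 6 and 5832 alpha = 4 * 1458 alpha; the rest is twice the
    constant of [exp_le_selsum_sq]. *)
Definition mse_const : R := 24 + 5832 * alpha + 32 * expR 2 + bad_const + 48.

(** On [good], T^2 = 4 s^2 (lam T)^2 with lam = 1 / (2 s) is bounded by exponentials whose exponent
    is at most 3 / (2 ln d) <= 2. Off [good], T^2 <= d S2 with S2 the sum of the x_i^2, and d S2 <=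
    d^4 / 2 + S2^2 / (2 d^2) separates the indicator from the moments. *)
Lemma exp_le_selsum_sq (lo hi : R) top : (lo = alpha * lf s) ->
  exp_le xi (fun x => (selsum lo hi top x) ^+ 2)
    ((16 * expR 2 + (bad_const + 48) / 2) * q s).
Proof.
move=> loE.
have lf1 := log_factor_ge1 d3 s0 s_small.
have lo0 : 0 <= lo by rewrite loE; apply: mulr_ge0 => //; lra.
have sp : 0 < s%:R :> R by rewrite ltr0n.
have s1 : 1 <= s%:R :> R by rewrite ler1n.
have sq : s%:R ^+ 2 <= q s by rewrite /log_rate ler_peMr ?sqr_ge0.
have q1 : 1 <= q s.
  by apply: le_trans sq; exact: exprn_ege1.
have N0 := N_gt0 R d3.
pose lam : R := (2 * s%:R)^-1.
have lam2 : lam ^+ 2 = 4^-1 * s%:R ^- 2 by rewrite /lam; field; rewrite gt_eqF.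
have lam4 : lam ^+ 2 <= 4^-1.
  rewrite lam2 ler_piMr// invf_le1 ?exprn_gt0//; exact: exprn_ege1.
have lam4' : (- lam) ^+ 2 <= 4^-1 by rewrite sqrrN.
have p := exp_le_selsum xi_iid theta sigma0 hi top (t := lo) _ _ lam4.
have n := exp_le_selsum xi_iid theta sigma0 hi top (t := lo) _ _ lam4'.
have {}p := p lo id (fun _ => lexx lo).
have {}n := n lo id (fun _ => lexx lo).
set e := expR (6 * lam ^+ 2 * _ * _) in p.
set e' := expR (6 * (- lam) ^+ 2 * _ * _) in n.
have e'E : e' = e by rewrite /e' sqrrN.
have eb : e <= expR 2.
  rewrite ler_expR lam2.
  have h : expR (- (lo / 8)) <= s%:R ^+ 2 / N.
    apply: le_trans (expRN_log_factor R d3 s0); rewrite ler_expR loE.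
    have : 48 * lf s <= alpha * lf s by rewrite ler_wpM2r ?ltW//; lra.
    lra.
  apply: (@le_trans _ _ (6 * (4^-1 * s%:R ^- 2) * d%:R * (s%:R ^+ 2 / N))).
    by apply: ler_wpM2l => //; rewrite !mulr_ge0 ?invr_ge0 ?exprn_ge0 ?ltW.
  have -> : 6 * (4^-1 * s%:R ^- 2) * d%:R * (s%:R ^+ 2 / N) = 3 / 2 * (ln d%:R)^-1.
    by field; rewrite !gt_eqF// (lt_le_trans _ ln1).
  have : (ln d%:R)^-1 <= 1 :> R by rewrite invf_le1 ?(lt_le_trans _ ln1).
  lra.
have bad4 := exp_leZ (a := d%:R ^+ 4 / 2) (divr_ge0 (exprn_ge0 4 (ltW d0)) (ler0n _ 2))
  exp_le_bad.
have pow := exp_leZ (a := (2 * d%:R)^-1) _ (exp_le_sum (index_enum 'I_d) (exp_le_pow4 xi_iid)).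
have {}pow := pow (ltac:(by rewrite invr_ge0 mulr_ge0// ltW)).
have pn := exp_leZ (a := 8 * s%:R ^+ 2) (mulr_ge0 (ler0n _ _) (exprn_ge0 2 (ltW sp)))
  (exp_leD p n).
apply: exp_leW (exp_leD pn (exp_leD bad4 pow)) => [x|]; last first.
  rewrite e'E sumr_const card_ord -(mulr_natl 48 d).
  have -> : d%:R ^+ 4 / 2 * (bad_const * d%:R ^- 4) = bad_const / 2.
    by field; rewrite gt_eqF.
  have -> : (2 * d%:R)^-1 * (d%:R * 48) = 24 :> R by field; rewrite gt_eqF.
  have h1 : 8 * s%:R ^+ 2 * (e + e) <= 16 * expR 2 * q s.
    have -> : 8 * s%:R ^+ 2 * (e + e) = 16 * (e * s%:R ^+ 2) by ring.
    rewrite -mulrA ler_pM2l//; by apply: ler_pM => //; exact: expR_ge0.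
  have h2 : (bad_const + 48) / 2 * 1 <= (bad_const + 48) / 2 * q s.
    by rewrite ler_wpM2l// divr_ge0// addr_ge0// bad_const_ge0.
  lra.
set Ts := selsum lo hi top x.
have pow0 : 0 <= (2 * d%:R)^-1 * \sum_(i < d) x i ^+ 4.
  apply: mulr_ge0; first by rewrite invr_ge0 mulr_ge0// ltW.
  by apply: sumr_ge0 => i _; rewrite exprn_even_ge0.
case: (boolP (good x)) => gx /=.
  rewrite mulr0 add0r !mul1r.
  have := sqr_le_cosh (lam * Ts); rewrite exprMn lam2 -mulNr => h.
  have : s%:R ^+ 2 * (4 * (4^-1 * s%:R ^- 2 * Ts ^+ 2)) <=
      s%:R ^+ 2 * (4 * (2 * (expR (lam * Ts) + expR (- lam * Ts)))).
    by rewrite ler_wpM2l ?sqr_ge0// ler_pM2l.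
  have -> : s%:R ^+ 2 * (4 * (4^-1 * s%:R ^- 2 * Ts ^+ 2)) = Ts ^+ 2.
    by field; rewrite gt_eqF.
  lra.
rewrite !mul0r addr0 mulr0 add0r mulr1.
have Tb : Ts ^+ 2 <= d%:R * \sum_(i < d) x i ^+ 2.
  rewrite /Ts /selsum; apply: (le_trans (sqr_sum_le _ _)).
  apply: ler_pM => //; first by apply: sumr_ge0 => i _; exact: sqr_ge0.
    by rewrite ler_nat -[leqRHS]card_ord max_card.
  rewrite [leLHS]big_mkcond /=; apply: ler_sum => i _.
  case: ifP => _; last exact: sqr_ge0.
  by rewrite exprMn ler_piMr ?sqr_ge0//; case: (sel _ _ _ _ _ _ _); rewrite ?expr1n ?expr0n.
have S4 : (\sum_(i < d) x i ^+ 2) ^+ 2 <= d%:R * \sum_(i < d) x i ^+ 4.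
  have := sqr_sum_le 'I_d (fun i => x i ^+ 2); rewrite card_ord.
  by under [X in _ <= _ * X -> _]eq_bigr do rewrite -exprM.
set S2 := \sum_(i < d) x i ^+ 2 in Tb S4.
set S := \sum_(i < d) x i ^+ 4 in S4 pow0 *.
apply: (le_trans Tb).
have h : S2 ^+ 2 / (2 * d%:R ^+ 2) <= (2 * d%:R)^-1 * S.
  rewrite ler_pdivrMr ?mulr_gt0 ?exprn_gt0//.
  have -> : (2 * d%:R)^-1 * S * (2 * d%:R ^+ 2) = d%:R * S by field; rewrite gt_eqF.
  exact: S4.
apply: (@le_trans _ _ (d%:R ^+ 4 / 2 + S2 ^+ 2 / (2 * d%:R ^+ 2))); last by rewrite lerD2l.
have -> : d%:R ^+ 4 / 2 + S2 ^+ 2 / (2 * d%:R ^+ 2) =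
    d%:R * S2 + (d%:R ^+ 2 - S2 / d%:R) ^+ 2 / 2 by field; rewrite gt_eqF.
by rewrite lerDl divr_ge0 ?sqr_ge0.
Qed.

End Sparse.
End Risk.

(** * The risk of the selected estimator *)

Section Lepski.
Context (R : realType) (d : nat).
Implicit Types (y : 'I_d -> R) (alpha beta : R).
Notation K := (Num.truncn (threshold_level R d)).
Notation q := (log_rate R d).

Lemma bigminn_mem (r : seq nat) (p : pred nat) n :
  let m := \big[minn/n]_(i <- r | p i) i in m = n \/ (m \in r /\ p m).
Proof.
rewrite /=; elim: r => [|i r IH]; first by left; rewrite big_nil.
rewrite big_cons; case: ifP => pi; last first.
  by case: IH => [->|[mr pm]]; [left | right; rewrite inE mr orbT].
rewrite /minn; case: ltnP => _; first by right; rewrite inE eqxx.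
by case: IH => [->|[mr pm]]; [left | right; rewrite inE mr orbT].
Qed.

Lemma bigminn_le (r : seq nat) (p : pred nat) n j : j \in r -> p j ->
  (\big[minn/n]_(i <- r | p i) i <= j)%N.
Proof.
elim: r => // i r IH; rewrite inE big_cons => /orP[/eqP->|jr] pj.
  by rewrite pj geq_minl.
by case: ifP => _; [rewrite geq_min IH// orbT | exact: IH].
Qed.

Lemma s_hat_mem alpha beta y : s_hat alpha beta y = K.+1 \/
  [/\ (0 < s_hat alpha beta y)%N, (s_hat alpha beta y <= K)%N &
      admissible alpha beta y (s_hat alpha beta y)].
Proof.
have [h|[]] := bigminn_mem (index_iota 1 K.+1) (admissible alpha beta y) K.+1.
  by left.
by rewrite mem_index_iota ltnS => /andP[h1 h2] h3; right.
Qed.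

Lemma s_hat_le alpha beta y r : (0 < r)%N -> (r <= K)%N ->
  admissible alpha beta y r -> (s_hat alpha beta y <= r)%N.
Proof.
by move=> r0 rK; apply: bigminn_le; rewrite mem_index_iota r0 ltnS.
Qed.

Lemma truncn_lt_threshold : threshold_level R d < K.+1%:R.
Proof. exact: truncnS_gt. Qed.

Lemma L_hat_at_last alpha y : L_hat_at alpha y K.+1 = \sum_(j < d) y j.
Proof. by rewrite /L_hat_at leNgt truncn_lt_threshold. Qed.

Lemma admissible_le alpha beta y r r' : admissible alpha beta y r ->
  (r < r' <= d)%N ->
  `|L_hat_at alpha y r - L_hat_at alpha y r'| <= omega beta y r'.
Proof. by move=> /allP h rr; apply: h; rewrite mem_index_iota ltnS. Qed.

Context (alpha beta : R).
Hypothesis beta0 : 0 <= beta.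
Hypothesis d3 : (3 <= d)%N.

Lemma omega_sqr y r : (0 < r)%N -> omega beta y r ^+ 2 = beta * sigma_hat y ^+ 2 * q r.
Proof.
move=> r0; rewrite sqr_sqrtr /log_rate ?mulrA//.
apply: mulr_ge0; last exact: log_factor_ge0.
by rewrite !mulr_ge0 ?sqr_ge0.
Qed.

Lemma sqr_le_of_norm_le (a b : R) : `|a| <= b -> a ^+ 2 <= b ^+ 2.
Proof.
move=> ab; rewrite -(@real_normK _ a) ?num_real// lerXn2r ?nnegrE//.
exact: le_trans ab.
Qed.

Lemma L_hat_sum_sqr y : (L_hat alpha beta y - \sum_(j < d) y j) ^+ 2 <=
  beta * sigma_hat y ^+ 2 * (d%:R * ln d%:R).
Proof.
have N0 := N_gt0 R d3.
have rhs0 : 0 <= beta * sigma_hat y ^+ 2 by rewrite mulr_ge0 ?sqr_ge0.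
rewrite /L_hat; case: (s_hat_mem alpha beta y) => [->|[h1 h2 h3]].
  rewrite L_hat_at_last subrr expr0n /=; apply: mulr_ge0 => //; exact: ltW.
rewrite -(L_hat_at_last alpha).
apply: (@le_trans _ _ (omega beta y K.+1 ^+ 2)).
  by apply: sqr_le_of_norm_le; apply: admissible_le h3 _;
    rewrite ltnS h2 (trunc_threshold_lt R d3).
by rewrite omega_sqr// ler_wpM2l// log_rate_le_N.
Qed.

(** Minimality gives [s_hat] <= s, and then it is the admissibility of [s_hat], rather than that of
    s, that compares the two estimators at the scale of s. *)
Lemma L_hat_near y s : (0 < s <= d)%N -> s%:R <= threshold_level R d ->
  admissible alpha beta y s ->
  (L_hat alpha beta y - L_hat_at alpha y s) ^+ 2 <= beta * sigma_hat y ^+ 2 * q s.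
Proof.
move=> /andP[s0 sd] ss adm.
have sK : (s <= K)%N by rewrite truncn_ge_nat// sqrtr_ge0.
have hs := s_hat_le s0 sK adm; rewrite /L_hat -(omega_sqr _ s0).
rewrite leq_eqVlt in hs; case/orP: hs => [/eqP->|hs].
  by rewrite subrr expr0n sqr_ge0.
apply: sqr_le_of_norm_le; case: (s_hat_mem alpha beta y) => [h|[_ _ h]].
  by rewrite h ltnNge leqW in hs.
by apply: admissible_le => //; rewrite hs.
Qed.

End Lepski.

(** * Risk below and above the threshold index *)

Section FinalBounds.
Context (R : realType) (d : nat) (disp : measure_display) (T : measurableType disp).
Context (P : probability T R) (xi : 'I_d -> {RV P >-> R}).
Hypothesis xi_iid : iid_standard_normal xi.
Context (theta : 'I_d -> R) (sigma : R) (s : nat) (alpha beta : R).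
Hypotheses (sigma0 : 0 < sigma) (theta_s : @sparse_vectors R d s theta).
Hypotheses (sd : s%:R < d%:R / 2 :> R) (d10 : (10 <= d)%N) (s0 : (0 < s)%N).
Hypothesis alpha48 : 48 < alpha.
Hypothesis beta_ge : 16 / 9 * (Num.sqrt 12 + 2 * Num.sqrt alpha) ^+ 2 <= beta.
Notation obs := (obs theta sigma).
Notation lf := (log_factor R d).
Notation q := (log_rate R d).
Notation N := (d%:R * ln d%:R : R).
Notation L := (linear_functional theta).
Implicit Types (x : vec R d).

Let d3 : (3 <= d)%N. Proof. exact: leq_trans d10. Qed.
Let d0 : 0 < d%:R :> R. Proof. by rewrite ltr0n (leq_trans _ d10). Qed.
Let ln1 : 1 <= ln d%:R :> R. Proof. exact: ln_d_ge1. Qed.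
Let alpha0 : 0 <= alpha. Proof. by apply: le_trans (ltW alpha48). Qed.
Let beta0 : 0 <= beta. Proof. exact: beta_ge0 beta_ge. Qed.
Let s_le_d : (0 < s <= d)%N.
Proof.
rewrite s0; apply: ltnW; apply: leq_ltn_trans (two_s_lt_d sd); exact: leq_pmull.
Qed.
Let s2 : 0 < sigma ^+ 2. Proof. by rewrite exprn_gt0. Qed.

Lemma sum_obs x : \sum_(j < d) obs x j - L = sigma * \sum_(j < d) x j.
Proof. by rewrite /obs /linear_functional big_split /= addrAC subrr add0r mulr_sumr. Qed.

Lemma sqrD_le (a b : R) : (a + b) ^+ 2 <= 2 * a ^+ 2 + 2 * b ^+ 2.
Proof. by rewrite -subr_ge0 (_ : _ - _ = (a - b) ^+ 2) ?sqr_ge0//; ring. Qed.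

Definition crude x : R := 2 * (beta * sigma_hat (obs x) ^+ 2 * N)
  + 2 * (sigma ^+ 2 * (\sum_(j < d) x j) ^+ 2).

Lemma L_hat_crude x : (L_hat alpha beta (obs x) - L) ^+ 2 <= crude x.
Proof.
rewrite -(subrKA (\sum_(j < d) obs x j)) sum_obs; apply: (le_trans (sqrD_le _ _)).
rewrite /crude exprMn lerD2r ler_pM2l//; exact: L_hat_sum_sqr.
Qed.

Section Small.
Hypothesis s_small : s%:R <= threshold_level R d.

(** On the support, a selected coordinate errs by sigma x_j and a rejected one by theta_j = y_j -
    sigma x_j with y_j^2 <= lo sigma_hat^2; at most s such errors are summed. Off the support the
    error is the selected noise. *)
Lemma exp_le_oracle : exp_le xi (fun x => (L_hat_at alpha (obs x) s - L) ^+ 2)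
  (mse_const alpha * (sigma ^+ 2 * q s)).
Proof.
have lf1 := log_factor_ge1 d3 s0 s_small.
set lo := alpha * lf s.
have lo0 : 0 <= lo by apply: mulr_ge0 => //; exact: le_trans lf1.
have sp : 0 <= s%:R :> R by [].
have sq : s%:R ^+ 2 <= q s by rewrite /log_rate ler_peMr ?sqr_ge0.
have c1 : 0 <= 4 * s%:R * sigma ^+ 2 by apply: mulr_ge0; [exact: mulr_ge0 | exact: ltW].
have c2 : 0 <= 4 * s%:R ^+ 2 * lo by apply: mulr_ge0 => //; apply: mulr_ge0 => //;
  exact: sqr_ge0.
have c3 : 0 <= 2 * sigma ^+ 2 by apply: mulr_ge0 => //; exact: ltW.
have E1 := exp_leZ c1 (exp_le_sum (enum (supp theta)) (exp_le_sqr xi_iid)).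
have E2 := exp_leZ c2 (exp_le_sigma_hat2 xi_iid sigma0 theta_s sd d3).
have E3 := exp_leZ c3 (exp_le_selsum_sq xi_iid theta sigma0 d10 s0 alpha48 s_small 0 true
  (erefl lo)).
apply: exp_leW (exp_leD (exp_leD E1 E2) E3) => [x|]; last first.
  rewrite big_enum sumr_const /= -(mulr_natl 6).
  have cs : #|supp theta|%:R <= s%:R :> R by rewrite ler_nat card_supp.
  have h1 : 4 * s%:R * sigma ^+ 2 * (#|supp theta|%:R * 6) <= 24 * (sigma ^+ 2 * q s).
    apply: (@le_trans _ _ (4 * s%:R * sigma ^+ 2 * (s%:R * 6))).
      by apply: ler_wpM2l => //; rewrite ler_wpM2r.
    have -> : 4 * s%:R * sigma ^+ 2 * (s%:R * 6) = 24 * (sigma ^+ 2 * s%:R ^+ 2) by ring.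
    by rewrite ler_pM2l// ler_pM2l.
  have h2 : 4 * s%:R ^+ 2 * lo * (1458 * sigma ^+ 2) = 5832 * alpha * (sigma ^+ 2 * q s).
    by rewrite /lo /log_rate; ring.
  have h3 : 2 * sigma ^+ 2 * ((16 * expR 2 + (bad_const R + 48) / 2) * q s) =
     (32 * expR 2 + bad_const R + 48) * (sigma ^+ 2 * q s) by field.
  rewrite h2 h3 /mse_const; lra.
set sh := sigma_hat (obs x).
pose b j := sel theta sigma lo 0 true x j.
set Ts := selsum theta sigma lo 0 true x.
pose e j := obs x j * (b j)%:R - theta j.
have split : L_hat_at alpha (obs x) s - L = \sum_(j in supp theta) e j + sigma * Ts.
  rewrite /L_hat_at s_small big_mkcond /linear_functional -sumrB /=.
  rewrite (bigID (mem (supp theta))) /=; congr (_ + _).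
    apply: eq_bigr => j _; rewrite /e /b /sel /= andbT -/sh /lo mulrAC.
    by case: ifP; rewrite ?mulr1 ?mulr0.
  rewrite /Ts /selsum mulr_sumr; apply: eq_big => [j|j js]; first by rewrite finset.in_setC.
  rewrite (theta_off js) subr0 /sel /= andbT -/sh /lo [alpha * lf s * _]mulrAC mulrA.
  by rewrite {2}/obs (theta_off js) add0r; case: ifP; rewrite ?mulr1 ?mulr0.
have e2 j : e j ^+ 2 <= 2 * sigma ^+ 2 * x j ^+ 2 + 2 * lo * sh ^+ 2.
  rewrite /e /b /sel andbT -/sh; case: ltP => h /=.
    rewrite mulr1 /obs [theta j + _]addrC addrK exprMn.
    have h1 : 0 <= sigma ^+ 2 * x j ^+ 2 by rewrite -exprMn sqr_ge0.
    have h2 : 0 <= lo * sh ^+ 2 by apply: mulr_ge0 => //; exact: sqr_ge0.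
    lra.
  rewrite mulr0 sub0r sqrrN.
  have -> : theta j = obs x j + - (sigma * x j) by rewrite /obs addrK.
  apply: (le_trans (sqrD_le _ _)); rewrite sqrrN exprMn; lra.
have A2 : (\sum_(j in supp theta) e j) ^+ 2 <=
    2 * s%:R * sigma ^+ 2 * \sum_(j in supp theta) x j ^+ 2 + 2 * s%:R ^+ 2 * lo * sh ^+ 2.
  have cs : #|supp theta|%:R <= s%:R :> R by rewrite ler_nat card_supp.
  have lsh0 : 0 <= 2 * lo * sh ^+ 2 by apply: mulr_ge0; [exact: mulr_ge0 | exact: sqr_ge0].
  apply: (le_trans (sqr_sum_le _ _)).
  apply: (@le_trans _ _ (s%:R * (2 * sigma ^+ 2 * \sum_(j in supp theta) x j ^+ 2 + s%:R
    * (2 * lo * sh ^+ 2)))).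
    apply: ler_pM => //; first by apply: sumr_ge0 => j _; exact: sqr_ge0.
    apply: (@le_trans _ _ (\sum_(j in supp theta) (2 * sigma ^+ 2 * x j ^+ 2 + 2 * lo *
      sh ^+ 2))).
      by apply: ler_sum => j _; exact: e2.
    rewrite big_split /= -mulr_sumr sumr_const lerD2l -(mulr_natl (_ * sh ^+ 2)).
    by rewrite ler_wpM2r.
  by rewrite le_eqVlt; apply/orP; left; apply/eqP; ring.
rewrite split; apply: (le_trans (sqrD_le _ _)); rewrite big_enum /= exprMn -/Ts -/sh.
lra.
Qed.

Definition small_const : R := 2916 * beta + 2 * mse_const alpha
  + (bad_const R + 2) / 2 + (4 * beta ^+ 2 * (243 ^+ 2 * 48) + 192 * expR 6).

Lemma exp_le_risk_small :
  exp_le xi (fun x => (L_hat alpha beta (obs x) - L) ^+ 2)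
    (small_const * (sigma ^+ 2 * q s)).
Proof.
have lnq := log_rate_ge_ln R d3 s0.
have q0 : 0 <= q s by exact: log_rate_ge0.
have b0 := bad_const_ge0 R.
(* Not being admissible has probability O(d^-2) and [crude] has second moment O(sigma^4 N^2), so
   this [eta] makes both eta P / 2 and E crude^2 / (2 eta) of order sigma^2 ln d, which is at most
   sigma^2 q s up to constants. *)
pose eta : R := sigma ^+ 2 * (d%:R ^+ 2 * ln d%:R).
have ln0 : 0 < ln d%:R :> R by exact: lt_le_trans ln1.
have eta0 : 0 < eta by rewrite /eta mulr_gt0// mulr_gt0// exprn_gt0.
have N0 := N_gt0 R d3.
have c1 : 0 <= 2 * (beta * q s) by apply: mulr_ge0 => //; exact: mulr_ge0.
have c2 : (0 : R) <= 2 by [].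
have c3 : 0 <= eta / 2 by rewrite divr_ge0// ltW.
have c4 : 0 <= 4 * (beta * N) ^+ 2 / eta by rewrite divr_ge0 ?(ltW eta0)// mulr_ge0// sqr_ge0.
have c5 : 0 <= 4 * sigma ^+ 4 / eta by rewrite divr_ge0 ?(ltW eta0)// mulr_ge0//
  exprn_ge0// ltW.
have E1 := exp_leZ c1 (exp_le_sigma_hat2 xi_iid sigma0 theta_s sd d3).
have E2 := exp_leZ c2 exp_le_oracle.
have E3 := exp_leZ c3 (exp_le_not_admissible xi_iid sigma0 theta_s d10 s0 alpha48 beta_ge
  s_small).
have E4 := exp_leZ c4 (exp_le_sigma_hat4 xi_iid sigma0 theta_s sd d3).
have E5 := exp_leZ c5 (exp_le_sum_pow4 xi_iid (leq_trans (isT : (4 <= 10)%N) d10)).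
apply: exp_leW (exp_leD (exp_leD E1 E2) (exp_leD E3 (exp_leD E4 E5))) => [x|]; last first.
  have -> : eta / 2 * ((bad_const R + 2) * d%:R ^- 2) =
      (bad_const R + 2) / 2 * (sigma ^+ 2 * ln d%:R).
    by rewrite /eta; field; rewrite gt_eqF.
  have -> : 4 * (beta * N) ^+ 2 / eta * (243 ^+ 2 * 48 * sigma ^+ 4) =
      (4 * beta ^+ 2 * (243 ^+ 2 * 48)) * (sigma ^+ 2 * ln d%:R).
    rewrite /eta; move: (243 ^+ 2 * 48) => k; field.
    by rewrite !gt_eqF.
  have -> : 4 * sigma ^+ 4 / eta * (48 * d%:R ^+ 2 * expR 6) =
      192 * expR 6 * (sigma ^+ 2 / ln d%:R).
    by rewrite /eta; field; rewrite !gt_eqF.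
  have := mulr_ge0 (exprn_ge0 2 (ler0n R 243)) (ler0n R 48).
  rewrite /small_const; move: (243 ^+ 2 * 48 : R) => k k0.
  have l1 : sigma ^+ 2 * ln d%:R <= sigma ^+ 2 * q s by rewrite ler_pM2l.
  have l2 : sigma ^+ 2 / ln d%:R <= sigma ^+ 2 * q s.
    apply: le_trans l1; rewrite ler_pM2l//; apply: le_trans ln1.
    by rewrite invf_le1.
  have m1 : (bad_const R + 2) / 2 * (sigma ^+ 2 * ln d%:R) <= (bad_const R + 2) / 2 *
    (sigma ^+ 2 * q s).
    by rewrite ler_wpM2l// divr_ge0// addr_ge0.
  have m2 : 4 * beta ^+ 2 * k * (sigma ^+ 2 * ln d%:R) <= 4 * beta ^+ 2 * k * (sigma ^+ 2
    * q s).
    by apply: ler_wpM2l => //; apply: mulr_ge0 => //; apply: mulr_ge0 => //; exact: sqr_ge0.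
  have m3 : 192 * expR 6 * (sigma ^+ 2 / ln d%:R) <= 192 * expR 6 * (sigma ^+ 2 * q s).
    by apply: ler_wpM2l => //; apply: mulr_ge0 => //; exact: expR_ge0.
  lra.
set sh := sigma_hat (obs x).
have sum0 : 0 <= 4 * (beta * N) ^+ 2 / eta * sh ^+ 4 + 4 * sigma ^+ 4 / eta * (\sum_(i <
  d) x i) ^+ 4.
  by apply: addr_ge0; apply: mulr_ge0 => //; rewrite exprn_even_ge0.
case: (boolP (admissible alpha beta (obs x) s)) => adm /=.
  rewrite mulr0 add0r.
  have near := L_hat_near beta0 d3 s_le_d s_small adm.
  rewrite -(subrKA (L_hat_at alpha (obs x) s)); apply: (le_trans (sqrD_le _ _)).
  rewrite -/sh in near *; lra.
rewrite mulr1.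
have or0 : 0 <= 2 * (beta * q s) * sh ^+ 2 + 2 * (L_hat_at alpha (obs x) s - L) ^+ 2.
  by apply: addr_ge0; apply: mulr_ge0 => //; exact: sqr_ge0.
apply: (le_trans (L_hat_crude x));
  apply: (@le_trans _ _ (eta / 2 + (4 * (beta * N) ^+ 2 / eta * sh ^+ 4 +
    4 * sigma ^+ 4 / eta * (\sum_(i < d) x i) ^+ 4))); last by rewrite lerDr.
set a := beta * sh ^+ 2 * N; set S := \sum_(i < d) x i.
have z2 : crude x ^+ 2 <= 8 * a ^+ 2 + 8 * (sigma ^+ 2 * S ^+ 2) ^+ 2.
  by rewrite /crude -/sh -/S -/a; apply: (le_trans (sqrD_le _ _)); rewrite !exprMn; lra.
have amgm : crude x <= eta / 2 + crude x ^+ 2 / (2 * eta).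
  rewrite -subr_ge0 (_ : _ - _ = (eta - crude x) ^+ 2 / (2 * eta)); last first.
    by field; rewrite gt_eqF.
  by rewrite divr_ge0 ?sqr_ge0// mulr_ge0// ltW.
apply: (le_trans amgm); rewrite lerD2l.
apply: (@le_trans _ _ ((8 * a ^+ 2 + 8 * (sigma ^+ 2 * S ^+ 2) ^+ 2) / (2 * eta))).
  by rewrite ler_wpM2r// invr_ge0 mulr_ge0// ltW.
rewrite le_eqVlt; apply/orP; left; apply/eqP; rewrite /a; field.
by rewrite gt_eqF.
Qed.

End Small.

Definition large_const : R := 5832 * beta + 4 * (1 + 48 * expR 6).

Lemma exp_le_risk_large : threshold_level R d < s%:R ->
  exp_le xi (fun x => (L_hat alpha beta (obs x) - L) ^+ 2)
    (large_const * (sigma ^+ 2 * q s)).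
Proof.
move=> large; have Nq := log_rate_ge_half d3 large; have N0 := N_gt0 R d3.
have c1 : 0 <= 2 * (beta * N) by apply: mulr_ge0 => //; apply: mulr_ge0 => //; exact: ltW.
have c2 : 0 <= 2 * sigma ^+ 2 / d%:R by apply: divr_ge0; [apply: mulr_ge0 => //;
  exact: ltW | exact: ltW].
have c3 : 0 <= 2 * sigma ^+ 2 * d%:R by apply: mulr_ge0; [apply: mulr_ge0 => //;
  exact: ltW | exact: ltW].
have E1 := exp_leZ c1 (exp_le_sigma_hat2 xi_iid sigma0 theta_s sd d3).
have E2 := exp_leZ c2 (exp_le_sum_pow4 xi_iid (leq_trans (isT : (4 <= 10)%N) d10)).
apply: exp_leW (exp_leD (exp_leD E1 E2) (exp_le_cst xi c3)) => [x|]; last first.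
  have -> : 2 * sigma ^+ 2 / d%:R * (48 * d%:R ^+ 2 * expR 6) =
    96 * expR 6 * (sigma ^+ 2 * d%:R) by field; rewrite gt_eqF.
  have dq : sigma ^+ 2 * d%:R <= 2 * (sigma ^+ 2 * q s).
    rewrite mulrCA ler_pM2l//; have := N_ge_d R d3; lra.
  have m1 : beta * (sigma ^+ 2 * N) <= beta * (sigma ^+ 2 * (2 * q s)).
    by apply: ler_wpM2l => //; rewrite ler_pM2l//; lra.
  have m2 : 96 * expR 6 * (sigma ^+ 2 * d%:R) <= 96 * expR 6 * (2 * (sigma ^+ 2 * q s)).
    by apply: ler_wpM2l => //; apply: mulr_ge0 => //; exact: expR_ge0.
  rewrite /large_const; lra.
apply: (le_trans (L_hat_crude x)); rewrite /crude; set S := \sum_(j < d) x j.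
(* Reduces the second moment of the sum to its fourth, already known to be O(d^2); both terms are
   then of order d <= N <= 2 q s. *)
have h : S ^+ 2 <= S ^+ 4 / d%:R + d%:R.
  have -> : S ^+ 4 / d%:R + d%:R = S ^+ 2 + (S ^+ 2 / d%:R - 1 / 2) ^+ 2 * d%:R + 3 / 4 * d%:R.
    by field; rewrite gt_eqF.
  rewrite -addrA lerDl; apply: addr_ge0; apply: mulr_ge0 => //; try exact: ltW.
  exact: sqr_ge0.
have m : 2 * sigma ^+ 2 * S ^+ 2 <= 2 * sigma ^+ 2 * (S ^+ 4 / d%:R + d%:R).
  by apply: ler_wpM2l => //; apply: mulr_ge0 => //; exact: ltW.
lra.
Qed.

End FinalBounds.

Theorem theorem3 (R : realType) :
  exists d0 : nat, (3 <= d0)%N /\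
  forall alpha beta : R,
    48 < alpha ->
    16 / 9 * (Num.sqrt 12 + 2 * Num.sqrt alpha) ^+ 2 <= beta ->
  exists C : R, 0 < C /\
  forall (d : nat) (sigma : R) (s : nat),
    (d0 <= d)%N -> 0 < sigma -> (1 <= s)%N -> s%:R < d%:R / 2 :> R ->
  forall (disp : measure_display) (T : measurableType disp)
         (P : probability T R) (xi : 'I_d -> {RV P >-> R}),
    iid_standard_normal xi ->
    (ereal_sup
       [set 'E_P[(fun w => (L_hat alpha beta (fun j => theta j + sigma * xi j w)
                            - linear_functional theta) ^+ 2)%R]
       | theta in @sparse_vectors R d s]
     <= (C * sigma ^+ 2 * s%:R ^+ 2
         * ln (1 + d%:R * ln d%:R / s%:R ^+ 2))%:E)%E.
Proof.
(* 10 is the size required by [sigma_hat_lower]; the other size conditions are weaker. Absolute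
   values in [C] settle positivity without discussing the signs of the two constants. *)
exists 10%N; split=> // alpha beta alpha48 beta_ge.
pose C := `|small_const alpha beta| + `|large_const beta| + 1.
exists C; split; first by rewrite ltr_wpDl// addr_ge0.
move=> d sigma s d10 sigma0 s0 sd disp T P xi xi_iid.
apply: ge_ereal_sup => _ [theta theta_s <-].
have rate0 : 0 <= sigma ^+ 2 * log_rate R d s.
  by rewrite mulr_ge0 ?sqr_ge0// log_rate_ge0// (leq_trans _ d10).
rewrite (_ : C * sigma ^+ 2 * s%:R ^+ 2 * ln (1 + d%:R * ln d%:R / s%:R ^+ 2) =
  C * (sigma ^+ 2 * log_rate R d s)); last by rewrite /log_rate !mulrA.
apply: (expectation_le_bound (F := fun x => (L_hat alpha beta (obs theta sigma x)
    - linear_functional theta) ^+ 2)); first by move=> x; exact: sqr_ge0.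
have [small|large] := leP (s%:R : R) (threshold_level R d).
  apply: exp_leW (exp_le_risk_small xi_iid sigma0 theta_s sd d10 s0 alpha48 beta_ge
    small) => //.
  apply: ler_wpM2r => //; apply: le_trans (ler_norm _) _.
  by rewrite /C -addrA lerDl addr_ge0.
apply: exp_leW (exp_le_risk_large xi_iid sigma0 theta_s sd d10 beta_ge large) => //.
apply: ler_wpM2r => //; apply: le_trans (ler_norm _) _.
by rewrite /C addrAC lerDr addr_ge0.
Qed.
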